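(* If $\vdash_\sigma P$ and $\langle\sigma;P\rangle\xrightarrow{\mu}\langle\sigma';P'\rangle$, then $\vdash_{\sigma'}P'$.
   Context: Asynchronous $\pi$-calculus: processes $P ::= a\langle\tilde b\rangle \mid\ !a(\tilde b).P \mid P|Q \mid (\nu a)P \mid G$, $G ::= \mathbf 0 \mid a(\tilde b).P \mid \tau.P \mid [a=b]G \mid G+G'$, well-sorted under a fixed sorting; $\xrightarrow{\mu}$ is the standard early LTS of the asynchronous $\pi$-calculus (actions $\tau$, early inputs $a(\tilde b)$, outputs $(\nu\tilde c)a\langle\tilde b\rangle$ with subject $a$); $\mathrm{fn}$ denotes free names. Names: output-controlled ($x,y,z$), input-controlled ($u,v,w$), continuation ($p,q,r$); $a,b,c$ range over output- and input-controlled names. Outputs at output-controlled names carry tuples $\tilde a,p$ ending with exactly one continuation name; continuation names are transmitted only this way. Sequentiality typing (continuation names count as output-controlled): $\vdash_1 u(\tilde a).P$ if $\vdash_1P$; $\vdash_0 x(\tilde a).P$, $\vdash_0 !x(\tilde a).P$ if $\vdash_1P$; $\vdash_1x\langle\tilde a\rangle$; $\vdash_0u\langle\tilde a\rangle$; $\vdash_\eta(\nu a)P$ if $\vdash_\eta P$; $\vdash_0\mathbf0$; $\vdash_{\eta_1+\eta_2}P|Q$ if $\vdash_{\eta_1}P,\vdash_{\eta_2}Q$, $\eta_1+\eta_2\le1$; $\vdash_\eta G_1+G_2$ if $\vdash_\eta G_1,G_2$; $\vdash_\eta\tau.P$ if $\vdash_\eta P$; $\vdash_0[a=b]G$ if $\vdash_0G$.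 Sequential type-allowed transition $\eta\vdash P\xrightarrow{\mu}P'$: $\vdash_\eta P$, $P\xrightarrow{\mu}P'$, and $\eta=0$, or $\mu=\tau$, or $\eta=1$ and $\mu$ is an input at an input-controlled name or an output at an output-controlled name. Stacks: sequences of $p^{\mathrm O}$/$p^{\mathrm I}$ with alternating tags, ending with an output tag unless empty, each name at most once per tag, and if a name has both tags the input occurrence immediately follows the output one; $|\sigma|$ is the length; $\mathrm{seq}(\sigma)=1$ if $\sigma$ starts with an output tag, else $0$. Interleaving $\sigma_1\in\sigma_2\between\sigma_3$: $\sigma_1$ is a stack derivable by $\emptyset\in\emptyset\between\emptyset$, and $t,\sigma_1\in\sigma_2\between t,\sigma_3$, $t,\sigma_1\in t,\sigma_2\between\sigma_3$ from $\sigma_1\in\sigma_2\between\sigma_3$ ($t$ a tagged name). Well-bracketing typing $\vdash_\sigma P$: $\vdash_{p^{\mathrm O}}p\langle\tilde a\rangle$; $\vdash_{p^{\mathrm O}}x\langle\tilde a,p\rangle$; $\vdash_\emptyset u\langle\tilde a\rangle$; $\vdash_{q^{\mathrm I},p^{\mathrm O}}q(\tilde a).P$ if $\vdash_{p^{\mathrm O}}P$, $p\ne q$; $\vdash_\emptyset x(\tilde a,p).P$, $\vdash_\emptyset !x(\tilde a,p).P$ if $\vdash_{p^{\mathrm O}}P$; $\vdash_{p^{\mathrm O}}u(\tilde a).P$ if $\vdash_{p^{\mathrm O}}P$; $\vdash_\emptyset\mathbf0$; $\vdash_{\xi,\sigma'}(\nu p)P$ if $\vdash_{\xi,p^{\mathrm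 O},p^{\mathrm I},\sigma'}P$ with $\xi$ empty or ending with an input tag; $\vdash_\sigma(\nu p)P$ if $\vdash_\sigma P$, $p\notin\sigma$; $\vdash_\sigma(\nu a)P$ if $\vdash_\sigma P$; $\vdash_\emptyset[a=b]P$ if $\vdash_\emptyset P$; $\vdash_{\sigma''}P|Q$ if $\vdash_\sigma P,\vdash_{\sigma'}Q$, $\sigma''\in\sigma\between\sigma'$; $\vdash_\sigma\tau.P$ if $\vdash_\sigma P$, $|\sigma|\le1$; $\vdash_\sigma P+Q$ if $\vdash_\sigma P,Q$, $|\sigma|\le1$. Typed transition $\sigma\vdash P\xrightarrow{\mu}P'$: $\vdash_\sigma P$; $\mathrm{seq}(\sigma)\vdash P\xrightarrow{\mu}P'$; and if a continuation name $p\in\mathrm{fn}(\mu)$ occurs in $\sigma$, then $\sigma=p^{\mathrm O},\sigma'$ or $\sigma=p^{\mathrm I},\sigma'$, and if moreover $p$ occurs in $\sigma'$ then $p$ is not the subject of $\mu$. $\langle\sigma;P\rangle\xrightarrow{\mu}\langle\sigma';P'\rangle$ holds when $\sigma\vdash P\xrightarrow{\mu}P'$ and: (1) if $\mu=(\nu\tilde b)p\langle\tilde a\rangle$ then $\sigma=p^{\mathrm O},\sigma'$; (2) if $\mu=p(\tilde a)$ then $\sigma=p^{\mathrm I},\sigma'$; (3) if $\mu=(\nu\tilde c,p)a\langle\tilde b,p\rangle$ then $\sigma'=p^{\mathrm I},\sigma$; (4) if $\mu=(\nu\tilde c)a\langle\tilde b,p\rangle$ ($p$ not extruded) then $\sigma=p^{\mathrm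 O},\sigma'$; (5) if $\mu=a(\tilde b,p)$ then $\sigma'=p^{\mathrm O},\sigma$; (6) if $\mu=\tau$, then $\sigma'=\sigma''$ when $\sigma=p^{\mathrm O},p^{\mathrm I},\sigma''$ and $p\notin\mathrm{fn}(P')$, and $\sigma'=\sigma$ otherwise.
   Formalization: For visible actions that mention no continuation name (inputs and outputs at input-controlled names), where clauses (1)–(6) do not determine σ′, the transition of configurations is taken to leave the stack unchanged, σ′ = σ; without this the claim fails. *)

(* Defs.v *)
From HB Require Import structures.
From mathcomp Require Import all_boot.

Set Implicit Arguments.
Unset Strict Implicit.
Unset Printing Implicit Defensive.

Variant nkind := KOut | KIn | KCont.

(* [obj s] is the tuple of sorts carried by the names of sort [s]. *)
Record sorting := Sorting {
  srt : eqType;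
  kind : srt -> nkind;
  obj : srt -> seq srt;
  obj_out : forall s, kind s = KOut ->
    exists ss c, [/\ obj s = rcons ss c, kind c = KCont
                   & forall s', s' \in ss -> kind s' <> KCont];
  obj_other : forall s, kind s <> KOut ->
    forall s', s' \in obj s -> kind s' <> KCont
}.

(* Every sort has countably many names. *)
Definition name (S : sorting) : eqType := (srt S * nat)%type.

Definition nsort (S : sorting) (a : name S) : srt S := a.1.

Definition isO (S : sorting) (a : name S) : bool :=
  if kind (nsort a) is KOut then true else false.
Definition isI (S : sorting) (a : name S) : bool :=
  if kind (nsort a) is KIn then true else false.
Definition isC (S : sorting) (a : name S) : bool :=
  if kind (nsort a) is KCont then true else false.
(* The range of the metavariables a, b, c. *)
Definition isA (S : sorting) (a : name S) : bool := ~~ isC a.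

(* Processes up to alpha-conversion: free names are explicit, bound names are
   de Bruijn indices; a binder for a tuple of n names binds the indices
   0, ..., n-1 and records their sorts. All judgements below are phrased with
   the named constructors [out], [inp], [rep], [mtch], [nu], so that terms with
   dangling indices are never well-sorted nor typable. *)
Variant occ (S : sorting) := Fr of name S | Bd of nat.

Inductive proc (S : sorting) :=
| POut of occ S & seq (occ S)
| PRep of occ S & seq (srt S) & proc S
| PPar of proc S & proc S
| PNu of srt S & proc S
| PGrd of grd S
with grd (S : sorting) :=
| GNil
| GIn of occ S & seq (srt S) & proc S
| GTau of proc S
| GMatch of occ S & occ S & grd S
| GSum of grd S & grd S.

Arguments GNil {S}.

Definition fn_occ (S : sorting) (o : occ S) : seq (name S) :=
  if o is Fr a then [:: a] else [::].

Fixpoint fn (S : sorting) (P : proc S) : seq (name S) :=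
  match P with
  | POut a bs => fn_occ a ++ flatten (map (@fn_occ S) bs)
  | PRep a _ P => fn_occ a ++ fn P
  | PPar P Q => fn P ++ fn Q
  | PNu _ P => fn P
  | PGrd G => fn_grd G
  end
with fn_grd (S : sorting) (G : grd S) : seq (name S) :=
  match G with
  | GNil => [::]
  | GIn a _ P => fn_occ a ++ fn P
  | GTau P => fn P
  | GMatch a b G => fn_occ a ++ fn_occ b ++ fn_grd G
  | GSum G G' => fn_grd G ++ fn_grd G'
  end.

(* [ren f P] applies f to the free names of P (no capture can occur). *)
Definition ren_occ (S : sorting) (f : name S -> name S) (o : occ S) : occ S :=
  if o is Fr a then Fr (f a) else o.

Fixpoint ren (S : sorting) (f : name S -> name S) (P : proc S) : proc S :=
  match P with
  | POut a bs => POut (ren_occ f a) (map (ren_occ f) bs)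
  | PRep a ss P => PRep (ren_occ f a) ss (ren f P)
  | PPar P Q => PPar (ren f P) (ren f Q)
  | PNu s P => PNu s (ren f P)
  | PGrd G => PGrd (ren_grd f G)
  end
with ren_grd (S : sorting) (f : name S -> name S) (G : grd S) : grd S :=
  match G with
  | GNil => GNil
  | GIn a ss P => GIn (ren_occ f a) ss (ren f P)
  | GTau P => GTau (ren f P)
  | GMatch a b G => GMatch (ren_occ f a) (ren_occ f b) (ren_grd f G)
  | GSum G G' => GSum (ren_grd f G) (ren_grd f G')
  end.

(* Simultaneous substitution P{cs/bs}, for tuples of the same length:
   a name outside bs has index [size bs] and is left unchanged. *)
Definition psubst (S : sorting) (bs cs : seq (name S)) (P : proc S) : proc S :=
  ren (fun a => nth a cs (index a bs)) P.

(* [close k bs P] turns the free names bs of P into the indices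
   k, ..., k + size bs - 1. *)
Definition close_occ (S : sorting) (k : nat) (bs : seq (name S)) (o : occ S) :
    occ S :=
  match o with
  | Fr a => if a \in bs then Bd S (k + index a bs) else Fr a
  | Bd i => if i < k then Bd S i else Bd S (i + size bs)
  end.

Fixpoint close (S : sorting) (k : nat) (bs : seq (name S)) (P : proc S) :
    proc S :=
  match P with
  | POut a cs => POut (close_occ k bs a) (map (close_occ k bs) cs)
  | PRep a ss P => PRep (close_occ k bs a) ss (close (k + size ss) bs P)
  | PPar P Q => PPar (close k bs P) (close k bs Q)
  | PNu s P => PNu s (close k.+1 bs P)
  | PGrd G => PGrd (close_grd k bs G)
  end
with close_grd (S : sorting) (k : nat) (bs : seq (name S)) (G : grd S) :
    grd S :=
  match G with
  | GNil => GNil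
  | GIn a ss P => GIn (close_occ k bs a) ss (close (k + size ss) bs P)
  | GTau P => GTau (close k bs P)
  | GMatch a b G =>
      GMatch (close_occ k bs a) (close_occ k bs b) (close_grd k bs G)
  | GSum G G' => GSum (close_grd k bs G) (close_grd k bs G')
  end.

Definition out (S : sorting) (a : name S) (bs : seq (name S)) : proc S :=
  POut (Fr a) (map (@Fr S) bs).
Definition inp (S : sorting) (a : name S) (bs : seq (name S)) (P : proc S) :
    grd S :=
  GIn (Fr a) (map (@nsort S) bs) (close 0 bs P).
Definition rep (S : sorting) (a : name S) (bs : seq (name S)) (P : proc S) :
    proc S :=
  PRep (Fr a) (map (@nsort S) bs) (close 0 bs P).
Definition mtch (S : sorting) (a b : name S) (G : grd S) : grd S :=
  GMatch (Fr a) (Fr b) G.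
Definition nu (S : sorting) (a : name S) (P : proc S) : proc S :=
  PNu (nsort a) (close 0 [:: a] P).
Definition nus (S : sorting) (cs : seq (name S)) (P : proc S) : proc S :=
  foldr (@nu S) P cs.

Inductive well_sorted (S : sorting) : proc S -> Prop :=
| ws_out a bs : map (@nsort S) bs = obj (nsort a) -> well_sorted (out a bs)
| ws_rep a bs P : uniq bs -> map (@nsort S) bs = obj (nsort a) ->
    well_sorted P -> well_sorted (rep a bs P)
| ws_par P Q : well_sorted P -> well_sorted Q -> well_sorted (PPar P Q)
| ws_nu a P : well_sorted P -> well_sorted (nu a P)
| ws_nil : well_sorted (PGrd GNil)
| ws_inp a bs P : uniq bs -> map (@nsort S) bs = obj (nsort a) ->
    well_sorted P -> well_sorted (PGrd (inp a bs P))
| ws_tau P : well_sorted P -> well_sorted (PGrd (GTau P))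
| ws_match a b G : well_sorted (PGrd G) -> well_sorted (PGrd (mtch a b G))
| ws_sum G G' : well_sorted (PGrd G) -> well_sorted (PGrd G') ->
    well_sorted (PGrd (GSum G G')).

(* [LOut cs a bs] is the output (nu cs) a<bs>. *)
Variant label (S : sorting) :=
| LTau
| LIn of name S & seq (name S)
| LOut of seq (name S) & name S & seq (name S).

Arguments LTau {S}.

Definition subj (S : sorting) (m : label S) : option (name S) :=
  match m with
  | LTau => None
  | LIn a _ => Some a
  | LOut _ a _ => Some a
  end.

Definition nm_label (S : sorting) (m : label S) : seq (name S) :=
  match m with
  | LTau => [::]
  | LIn a bs => a :: bs
  | LOut cs a bs => cs ++ a :: bs
  end.

Definition bn_label (S : sorting) (m : label S) : seq (name S) :=
  if m is LOut cs _ _ then cs else [::].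

(* Names received by an early input are free. *)
Definition fn_label (S : sorting) (m : label S) : seq (name S) :=
  [seq a <- nm_label m | a \notin bn_label m].

Definition disj (T : eqType) (s t : seq T) : bool := ~~ has (mem t) s.

(* Early transitions. Communication rules also cover scope closing: the
   extruded names cs may be empty. *)
Inductive step (S : sorting) : proc S -> label S -> proc S -> Prop :=
| st_out a bs : step (out a bs) (LOut [::] a bs) (PGrd GNil)
| st_inp a bs cs P : uniq bs -> map (@nsort S) cs = map (@nsort S) bs ->
    step (PGrd (inp a bs P)) (LIn a cs) (psubst bs cs P)
| st_rep a bs cs P : uniq bs -> map (@nsort S) cs = map (@nsort S) bs ->
    step (rep a bs P) (LIn a cs) (PPar (psubst bs cs P) (rep a bs P))
| st_tau P : step (PGrd (GTau P)) LTau P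
| st_match a G m P' : step (PGrd G) m P' -> step (PGrd (mtch a a G)) m P'
| st_suml G G' m P' : step (PGrd G) m P' -> step (PGrd (GSum G G')) m P'
| st_sumr G G' m P' : step (PGrd G') m P' -> step (PGrd (GSum G G')) m P'
| st_parl P Q m P' : step P m P' -> disj (bn_label m) (fn Q) ->
    step (PPar P Q) m (PPar P' Q)
| st_parr P Q m Q' : step Q m Q' -> disj (bn_label m) (fn P) ->
    step (PPar P Q) m (PPar P Q')
| st_comml P Q cs a bs P' Q' : step P (LOut cs a bs) P' ->
    step Q (LIn a bs) Q' -> disj cs (fn Q) ->
    step (PPar P Q) LTau (nus cs (PPar P' Q'))
| st_commr P Q cs a bs P' Q' : step P (LIn a bs) P' ->
    step Q (LOut cs a bs) Q' -> disj cs (fn P) ->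
    step (PPar P Q) LTau (nus cs (PPar P' Q'))
| st_res c P m P' : step P m P' -> c \notin nm_label m ->
    step (nu c P) m (nu c P')
| st_open c P cs a bs P' : step P (LOut cs a bs) P' ->
    c \in bs -> c \notin cs -> c != a ->
    step (nu c P) (LOut (c :: cs) a bs) P'.

(* Sequentiality. Continuation names count as output-controlled, so
   "output-controlled" is ~~ isI here. *)
Inductive seq_typed (S : sorting) : nat -> proc S -> Prop :=
| sq_inI u bs P : isI u -> uniq bs -> seq_typed 1 P ->
    seq_typed 1 (PGrd (inp u bs P))
| sq_inO x bs P : ~~ isI x -> uniq bs -> seq_typed 1 P ->
    seq_typed 0 (PGrd (inp x bs P))
| sq_rep x bs P : ~~ isI x -> uniq bs -> seq_typed 1 P ->
    seq_typed 0 (rep x bs P)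
| sq_outO x bs : ~~ isI x -> seq_typed 1 (out x bs)
| sq_outI u bs : isI u -> seq_typed 0 (out u bs)
| sq_nu eta a P : seq_typed eta P -> seq_typed eta (nu a P)
| sq_nil : seq_typed 0 (PGrd GNil)
| sq_par eta1 eta2 P Q : seq_typed eta1 P -> seq_typed eta2 Q ->
    eta1 + eta2 <= 1 -> seq_typed (eta1 + eta2) (PPar P Q)
| sq_sum eta G1 G2 : seq_typed eta (PGrd G1) -> seq_typed eta (PGrd G2) ->
    seq_typed eta (PGrd (GSum G1 G2))
| sq_tau eta P : seq_typed eta P -> seq_typed eta (PGrd (GTau P))
| sq_match a b G : seq_typed 0 (PGrd G) -> seq_typed 0 (PGrd (mtch a b G)).

Definition seq_allowed (S : sorting) (m : label S) : bool :=
  match m with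
  | LTau => false
  | LIn a _ => isI a
  | LOut _ a _ => ~~ isI a
  end.

Definition seq_step (S : sorting) (eta : nat) (P : proc S) (m : label S)
    (P' : proc S) : Prop :=
  [/\ seq_typed eta P, step P m P'
    & [\/ eta = 0, m = LTau | eta = 1 /\ seq_allowed m]].

Variant tag := TO | TI.
Definition bool_of_tag (t : tag) : bool := if t is TO then true else false.
Definition tag_of_bool (b : bool) : tag := if b then TO else TI.
Lemma bool_of_tagK : cancel bool_of_tag tag_of_bool.
Proof. by case. Qed.
HB.instance Definition _ := Equality.copy tag (can_type bool_of_tagK).

Definition tname (S : sorting) : eqType := (name S * tag)%type.

Definition names (S : sorting) (s : seq (tname S)) : seq (name S) :=
  map fst s.

Record is_stack (S : sorting) (s : seq (tname S)) : Prop := IsStack {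
  stack_cont : all (@isC S) (names s);
  stack_alt : sorted (fun t t' : tname S => t.2 != t'.2) s;
  stack_last : last TO (map snd s) = TO;
  stack_uniq : uniq s;
  stack_next : forall p : name S, (p, TO) \in s -> (p, TI) \in s ->
    infix [:: (p, TO); (p, TI)] s
}.

Definition seq_of (S : sorting) (s : seq (tname S)) : nat :=
  if s is (_, TO) :: _ then 1 else 0.

Inductive shuffle (T : Type) : seq T -> seq T -> seq T -> Prop :=
| sh_nil : shuffle [::] [::] [::]
| sh_r t s1 s2 s3 : shuffle s1 s2 s3 -> shuffle (t :: s1) s2 (t :: s3)
| sh_l t s1 s2 s3 : shuffle s1 s2 s3 -> shuffle (t :: s1) (t :: s2) s3.

Definition interleaving (S : sorting) (s1 s2 s3 : seq (tname S)) : Prop :=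
  is_stack s1 /\ shuffle s1 s2 s3.

Inductive wb_typed (S : sorting) : seq (tname S) -> proc S -> Prop :=
| wb_outC p bs : isC p -> all (@isA S) bs ->
    wb_typed [:: (p, TO)] (out p bs)
| wb_outO x bs p : isO x -> all (@isA S) bs -> isC p ->
    wb_typed [:: (p, TO)] (out x (rcons bs p))
| wb_outI u bs : isI u -> all (@isA S) bs ->
    wb_typed [::] (out u bs)
| wb_inC q bs p P : isC q -> all (@isA S) bs -> uniq bs -> isC p -> p != q ->
    wb_typed [:: (p, TO)] P ->
    wb_typed [:: (q, TI); (p, TO)] (PGrd (inp q bs P))
| wb_inO x bs p P : isO x -> all (@isA S) bs -> uniq bs -> isC p ->
    wb_typed [:: (p, TO)] P ->
    wb_typed [::] (PGrd (inp x (rcons bs p) P))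
| wb_rep x bs p P : isO x -> all (@isA S) bs -> uniq bs -> isC p ->
    wb_typed [:: (p, TO)] P ->
    wb_typed [::] (rep x (rcons bs p) P)
| wb_inI u bs p P : isI u -> all (@isA S) bs -> uniq bs -> isC p ->
    wb_typed [:: (p, TO)] P ->
    wb_typed [:: (p, TO)] (PGrd (inp u bs P))
| wb_nil : wb_typed [::] (PGrd GNil)
| wb_nuC xi p s P : isC p ->
    (xi = [::] \/ exists xi' q, xi = rcons xi' (q, TI)) ->
    wb_typed (xi ++ [:: (p, TO), (p, TI) & s]) P ->
    wb_typed (xi ++ s) (nu p P)
| wb_nuC' s p P : isC p -> p \notin names s ->
    wb_typed s P -> wb_typed s (nu p P)
| wb_nuA s a P : isA a -> wb_typed s P -> wb_typed s (nu a P)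
| wb_match a b G : isA a -> isA b ->
    wb_typed [::] (PGrd G) -> wb_typed [::] (PGrd (mtch a b G))
| wb_par s s1 s2 P Q : wb_typed s1 P -> wb_typed s2 Q ->
    interleaving s s1 s2 -> wb_typed s (PPar P Q)
| wb_tau s P : size s <= 1 -> wb_typed s P -> wb_typed s (PGrd (GTau P))
| wb_sum s G G' : size s <= 1 -> wb_typed s (PGrd G) ->
    wb_typed s (PGrd G') -> wb_typed s (PGrd (GSum G G')).

Definition wb_step (S : sorting) (s : seq (tname S)) (P : proc S)
    (m : label S) (P' : proc S) : Prop :=
  [/\ wb_typed s P, seq_step (seq_of s) P m P'
    & forall p : name S, isC p -> p \in fn_label m -> p \in names s ->
        exists t s', s = (p, t) :: s' /\
          (p \in names s' -> subj m <> Some p)].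

(* The last clause makes explicit that the stack is left unchanged by the
   visible actions covered by no other clause, i.e. those that mention no
   continuation name. *)
Record conf_step (S : sorting) (s : seq (tname S)) (P : proc S)
    (m : label S) (s' : seq (tname S)) (P' : proc S) : Prop := ConfStep {
  cs_step : wb_step s P m P';
  cs_outC : forall cs p bs, isC p -> m = LOut cs p bs -> s = (p, TO) :: s';
  cs_inC : forall p bs, isC p -> m = LIn p bs -> s = (p, TI) :: s';
  cs_extr : forall cs a bs p, isA a -> isC p ->
    m = LOut cs a (rcons bs p) -> p \in cs -> s' = (p, TI) :: s;
  cs_outA : forall cs a bs p, isA a -> isC p ->
    m = LOut cs a (rcons bs p) -> p \notin cs -> s = (p, TO) :: s';
  cs_inA : forall a bs p, isA a -> isC p ->
    m = LIn a (rcons bs p) -> s' = (p, TO) :: s;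
  cs_tau_pop : forall p s'', m = LTau ->
    s = [:: (p, TO), (p, TI) & s''] -> p \notin fn P' -> s' = s'';
  cs_tau : m = LTau ->
    ~ (exists p s'', s = [:: (p, TO), (p, TI) & s''] /\ p \notin fn P') ->
    s' = s;
  cs_other : m <> LTau -> all (@isA S) (nm_label m) -> s' = s
}.

(* Main.v *)
Require Import Defs.
From mathcomp Require Import all_boot.

(* Typing constrains even the untyped transitions. The tags of a stack alternate
   and end with an output, so seq_of is the excess of outputs over inputs and is
   additive over interleavings: in P | Q at most one component has a stack
   starting with an output. Hence an output of P at, or carrying, a continuation
   name p always has p^O at the head of the stack of P, and if p is extruded then
   its stack was p^O, p^I, s with s starting with an output. For a communication
   the stack condition "p^I immediately follows p^O" then puts the receiver's p^I
   at the head of its own stack, so that both pop together. Each kind of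
   transition is thus described by a relation between stacks that is stable under
   parallel composition and restriction; the side conditions on typed transitions
   are only needed for inputs at the top level. *)

Set Implicit Arguments.
Unset Strict Implicit.
Unset Printing Implicit Defensive.

Scheme proc_grd_ind := Induction for proc Sort Prop
with grd_proc_ind := Induction for grd Sort Prop.
Combined Scheme proc_grd_mutind from proc_grd_ind, grd_proc_ind.

(** * Opening, closing and renaming of bound names *)

Section Syntax.
Context {S : sorting}.
Implicit Types (a b c p q : name S) (bs cs : seq (name S)) (o : occ S).
Implicit Types (P Q : proc S) (G : grd S) (f g : name S -> name S).

(** Opening is what undoes [close]: it serves to compare two presentations
    [close 0 bs P = close 0 bs' Q] of one binder body. An index past the block falls out of the
    range of [nth], and the default [i - size cs] cancels the shift made by [close_occ]. *)
Definition open_occ (k : nat) cs o : occ S :=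
  match o with
  | Fr a => Fr a
  | Bd i => if i < k then Bd S i
            else nth (Bd S (i - size cs)) (map (@Fr S) cs) (i - k)
  end.

Fixpoint open (k : nat) cs P : proc S :=
  match P with
  | POut a os => POut (open_occ k cs a) (map (open_occ k cs) os)
  | PRep a ss P => PRep (open_occ k cs a) ss (open (k + size ss) cs P)
  | PPar P Q => PPar (open k cs P) (open k cs Q)
  | PNu s P => PNu s (open k.+1 cs P)
  | PGrd G => PGrd (open_grd k cs G)
  end
with open_grd (k : nat) cs G : grd S :=
  match G with
  | GNil => GNil
  | GIn a ss P => GIn (open_occ k cs a) ss (open (k + size ss) cs P)
  | GTau P => GTau (open k cs P)
  | GMatch a b G => GMatch (open_occ k cs a) (open_occ k cs b) (open_grd k cs G)
  | GSum G G' => GSum (open_grd k cs G) (open_grd k cs G')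
  end.

Lemma open_close_occ k bs cs o : size cs = size bs ->
  open_occ k cs (close_occ k bs o) =
    ren_occ (fun a => nth a cs (index a bs)) o.
Proof.
case: o => [a|i] /= sz.
  case: ifP => /= ab; last by rewrite nth_default // sz memNindex ?ab.
  rewrite ltnNge leq_addr /= addKn (nth_map a) // sz index_mem //.
case: ltnP => /= ik; first by rewrite ik.
by rewrite ltnNge (leq_trans ik (leq_addr _ _)) /= nth_default ?sz ?addnK //
  size_map sz leq_subRL ?leq_add2r // (leq_trans ik (leq_addr _ _)).
Qed.

Lemma open_close bs cs P : size cs = size bs ->
  forall k, open k cs (close k bs P) = psubst bs cs P.
Proof.
move=> sz; rewrite /psubst; set f := fun a => _.
have occE k o : open_occ k cs (close_occ k bs o) = ren_occ f o.
  exact: open_close_occ.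
suff [H _] : (forall P k, open k cs (close k bs P) = ren f P) /\
  (forall G k, open_grd k cs (close_grd k bs G) = ren_grd f G) by exact: H.
apply: proc_grd_mutind => //=
  [o os|o ss {}P IH|{}P IHP Q IHQ|s {}P IH|G IH|o ss {}P IH|{}P IH
  |o o' G IH|G IH G' IH'] k;
  rewrite ?occE ?IH ?IH' ?IHP ?IHQ //.
by rewrite -map_comp; congr POut; apply: eq_map => o' /=; rewrite occE.
Qed.

Lemma ren_id f P : f =1 id -> ren f P = P.
Proof.
move=> fE; have occE o : ren_occ f o = o by case: o => //= a; rewrite fE.
suff [H _] : (forall P, ren f P = P) /\ (forall G, ren_grd f G = G) by exact: H.
apply: proc_grd_mutind => //=
  [o os|o ss {}P ->|{}P -> Q ->|s {}P ->|G ->|o ss {}P ->|{}P ->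
  |o o' G ->|G -> G' ->]; rewrite ?occE //.
by rewrite (eq_map occE) map_id.
Qed.

Lemma psubst_id bs P : psubst bs bs P = P.
Proof.
apply: ren_id => a; have [ab|ab] := boolP (a \in bs); first exact: nth_index.
by rewrite nth_default // memNindex.
Qed.

Lemma mem_fn_close_occ k bs a o :
  (a \in fn_occ (close_occ k bs o)) = (a \in fn_occ o) && (a \notin bs).
Proof.
case: o => [b|i] /=; last by case: ifP.
case: ifP => /= bbs; rewrite ?inE; case: eqP => //= ->; by rewrite bbs.
Qed.

Lemma mem_fn_close bs a P k :
  (a \in fn (close k bs P)) = (a \in fn P) && (a \notin bs).
Proof.
suff [H _] :
  (forall P k, (a \in fn (close k bs P)) = (a \in fn P) && (a \notin bs)) /\
  (forall G k, (a \in fn_grd (close_grd k bs G)) =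
     (a \in fn_grd G) && (a \notin bs)) by exact: H.
apply: proc_grd_mutind => //=
  [o os|o ss {}P IH|{}P IHP Q IHQ|o ss {}P IH|o o' G IH|G IH G' IH'] {}k;
  rewrite ?mem_cat ?mem_fn_close_occ ?IH ?IH' ?IHP ?IHQ -?andb_orl //.
rewrite andb_orl; congr orb.
elim: os => //= o' os IH; by rewrite !mem_cat mem_fn_close_occ IH andb_orl.
Qed.

(** Alpha-conversion combined with renaming: the binder's names change from [bs] to [bs'] while [f]
    passes under it. The last hypothesis prevents [bs'] from capturing images of free names. *)
Lemma ren_close f bs bs' P k : size bs' = size bs -> uniq bs' ->
  (forall a, a \in fn P -> a \notin bs -> f a \notin bs') ->
  ren f (close k bs P) =
    close k bs' (ren (fun a => nth (f a) bs' (index a bs)) P).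
Proof.
move=> sz U; set g := fun a => _.
have occE j o : (forall a, a \in fn_occ o -> a \notin bs -> f a \notin bs') ->
    ren_occ f (close_occ j bs o) = close_occ j bs' (ren_occ g o).
  case: o => [a|i] /= H; last by case: ifP => //= _; rewrite sz.
  rewrite /g; case: ifPn => /= ab.
    have ib : index a bs < size bs' by rewrite sz index_mem.
    by rewrite mem_nth // index_uniq.
  (* Outside [bs] the index is [size bs], so [nth] returns its default [f a]. *)
  by rewrite memNindex // -sz nth_default // (negPf (H a (mem_head _ _) ab)).
pose ok (s : seq (name S)) := forall a, a \in s -> a \notin bs -> f a \notin bs'.
have okl s t : ok (s ++ t) -> ok s by move=> H a ia; apply: H; rewrite mem_cat ia.
have okr s t : ok (s ++ t) -> ok t.
  by move=> H a ia; apply: H; rewrite mem_cat ia orbT.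
suff [H _] :
  (forall P k, ok (fn P) -> ren f (close k bs P) = close k bs' (ren g P)) /\
  (forall G k, ok (fn_grd G) ->
     ren_grd f (close_grd k bs G) = close_grd k bs' (ren_grd g G)) by exact: H.
apply: proc_grd_mutind => //=
  [o os|o ss {}P IH|{}P IHP Q IHQ|s {}P IH|G IH|o ss {}P IH|{}P IH
  |o o' G IH|G IH G' IH'] {}k H.
- rewrite (occE _ _ (okl _ _ H)) -!map_comp; congr POut.
  move/okr: H; elim: os => //= o' os IH H.
  by rewrite (occE _ _ (okl _ _ H)) IH //; apply: okr H.
- by rewrite (occE _ _ (okl _ _ H)) IH //; apply: okr H.
- by rewrite IHP ?IHQ //; [apply: okr H|apply: okl H].
- by rewrite IH.
- by rewrite IH.
- by rewrite (occE _ _ (okl _ _ H)) IH //; apply: okr H.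
- by rewrite IH.
- rewrite (occE _ _ (okl _ _ H)); move/okr: H => H.
  by rewrite (occE _ _ (okl _ _ H)) IH //; apply: okr H.
- by rewrite IH ?IH' //; [apply: okr H|apply: okl H].
Qed.

Lemma mem_fn_out a b bs : (a \in fn (out b bs)) = (a \in b :: bs).
Proof.
rewrite /= !inE; congr orb; elim: bs => //= c bs IH; by rewrite !inE IH.
Qed.

Lemma ren_out f a bs : ren f (out a bs) = out (f a) (map f bs).
Proof. by rewrite /out /= -!map_comp. Qed.

(** A name is a sort with a number, so numbers beyond the maximum over [L] give freshness whatever
    the sorts, and consecutive numbers give distinctness. *)
Definition fresh_names (L bs : seq (name S)) : seq (name S) :=
  let N := (\max_(a <- L) a.2).+1 in
  zip (map (@nsort S) bs) (iota N (size bs)).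

Lemma fresh_namesP L bs : [/\ size (fresh_names L bs) = size bs,
  map (@nsort S) (fresh_names L bs) = map (@nsort S) bs,
  uniq (fresh_names L bs) & forall a, a \in L -> a \notin fresh_names L bs].
Proof.
rewrite /fresh_names; set N := _.+1.
have sz : size (map (@nsort S) bs) = size (iota N (size bs)).
  by rewrite size_map size_iota.
have E2 : map snd (zip (map (@nsort S) bs) (iota N (size bs))) = iota N (size bs).
  by rewrite -/unzip2 unzip2_zip // sz.
split.
- by rewrite size_zip size_map size_iota minnn.
- by rewrite -[LHS]/(unzip1 _) unzip1_zip // sz.
- by apply: (@map_uniq _ _ snd); rewrite E2 iota_uniq.
- move=> a aL; apply/negP => /(map_f snd); rewrite E2 mem_iota => /andP [+ _].
  by rewrite /N ltnNge (leq_bigmax_seq a).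
Qed.

(** * Kinds of names *)

Lemma isA_sort a b : nsort a = nsort b -> isA a = isA b.
Proof. by rewrite /isA /isC => ->. Qed.
Lemma isC_sort a b : nsort a = nsort b -> isC a = isC b.
Proof. by rewrite /isC => ->. Qed.
Lemma isO_sort a b : nsort a = nsort b -> isO a = isO b.
Proof. by rewrite /isO => ->. Qed.
Lemma isI_sort a b : nsort a = nsort b -> isI a = isI b.
Proof. by rewrite /isI => ->. Qed.

Lemma isO_isA a : isO a -> isA a.
Proof. by rewrite /isO /isA /isC; case: kind. Qed.
Lemma isI_isA a : isI a -> isA a.
Proof. by rewrite /isI /isA /isC; case: kind. Qed.
Lemma isC_isO a : isC a -> isO a -> False.
Proof. by rewrite /isO /isC; case: kind. Qed.
Lemma isC_isI a : isC a -> isI a -> False.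
Proof. by rewrite /isI /isC; case: kind. Qed.
Lemma isO_isI a : isO a -> isI a -> False.
Proof. by rewrite /isI /isO; case: kind. Qed.

Lemma all_isA_sort bs cs : map (@nsort S) bs = map (@nsort S) cs ->
  all (@isA S) bs = all (@isA S) cs.
Proof.
elim: bs cs => [|b bs IH] [|c cs] //= [E /IH ->]; by rewrite (isA_sort E).
Qed.

Lemma map_rconsP cs bs p :
  map (@nsort S) cs = map (@nsort S) (rcons bs p) ->
  exists cs' q, [/\ cs = rcons cs' q, map (@nsort S) cs' = map (@nsort S) bs
                  & nsort q = nsort p].
Proof.
case/lastP: cs => [|cs q]; first by move/(congr1 size); rewrite !size_map size_rcons.
by rewrite !map_rcons => /rcons_inj [E1 E2]; exists cs, q.
Qed.

Lemma isA_isC_neq a p : isA a -> isC p -> a != p.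
Proof. by move=> aA pC; apply: contraNneq aA => ->. Qed.

Lemma allA_notin p bs : isC p -> all (@isA S) bs -> p \notin bs.
Proof. by move=> pC /allP bsA; apply/negP => /bsA; rewrite /isA pC. Qed.

End Syntax.

(** * Recursive description of stacks *)

Section Stacks.
Context {S : sorting}.
Implicit Types (p q : name S) (s xi : seq (tname S)) (t : tname S).

(** Together with [is_stack_TI] this replaces the global conditions by conditions on the head, so
    that stacks can be treated by induction. Alternation becomes a value of [seq_of], and the infix
    condition says that p^I can only be the very next entry. *)
Lemma is_stack_TO p s : is_stack ((p, TO) :: s) <->
  [/\ isC p, is_stack s, seq_of s = 0, (p, TO) \notin s
    & (p, TI) \in s -> exists s', s = (p, TI) :: s'].
Proof.
split=> [[/=/andP [pC sC] alt lst /andP [pN U] nxt]|[pC [sC alt lst U nxt] s0 pN hd]].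
  split=> //.
  - split=> //; first by move/path_sorted: alt.
    move=> r rO rI; have := nxt r; rewrite !inE rO rI !orbT /= => /(_ isT isT).
    case/orP => //; rewrite !xpair_eqE andbT => /andP [/eqP rp _].
    by rewrite -rp rO in pN.
  - by case: s alt {lst pN U nxt sC} => [|[q []] s].
  (* The pair p^O, p^I either starts at the head or lies in the tail, where it would repeat p^O. *)
  - move=> pI; have := nxt p; rewrite !inE pI eqxx orbT => /(_ isT isT).
    case/orP; last first.
      by move/mem_infix => /(_ (p, TO)); rewrite mem_head (negPf pN) => /(_ isT).
    case: s {alt lst pN U nxt sC pI} => // t s /=.
    by rewrite andbC => /andP [_ /eqP <-]; exists s.
split=> //=.
- by rewrite pC.
- by case: s s0 alt {lst pN U nxt sC hd} => [|[q []] s].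
- by rewrite pN.
- move=> r; rewrite !inE !xpair_eqE andbT andbF /=.
  have [-> _ /hd [s' ->]|_ /= rO rI] := eqVneq r p; last by rewrite nxt ?orbT.
  by rewrite /= eqxx prefix0s.
Qed.

Lemma is_stack_TI p s : is_stack ((p, TI) :: s) <->
  [/\ isC p, is_stack s, seq_of s = 1 & p \notin names s].
Proof.
split=> [[/=/andP [pC sC] alt lst /andP [pN U] nxt]|[pC [sC alt lst U nxt] s1 pN]].
  split=> //.
  - split=> //; first by move/path_sorted: alt.
      by case: s lst {alt pN U nxt sC}.
    move=> r rO rI; have := nxt r; rewrite !inE rO rI !orbT => /(_ isT isT).
    by rewrite !xpair_eqE andbF.
  - by case: s alt lst {pN U nxt sC} => [|[q []] s].
  - apply/negP => /mapP [[q []] qs /= E]; rewrite -{q}E in qs; last by rewrite qs in pN.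
    have := nxt p; rewrite !inE qs eqxx orbT => /(_ isT isT).
    rewrite xpair_eqE andbF /= => /mem_infix /(_ (p, TI)).
    by rewrite !inE eqxx orbT (negPf pN) => /(_ isT).
split=> //=.
- by rewrite pC.
- by case: s s1 alt {lst pN U nxt sC} => [|[q []] s].
- by case: s s1 lst {alt pN U nxt sC}.
- rewrite U andbT; apply: contra pN; exact: (map_f fst).
- move=> r; rewrite !inE !xpair_eqE andbF andbT /= => rO /orP [/eqP rp|rI].
    by rewrite -rp (map_f fst rO) in pN.
  by rewrite nxt ?orbT.
Qed.

Lemma is_stack_nil : is_stack ([::] : seq (tname S)).
Proof. by split. Qed.

Lemma is_stack_seq1 p : isC p -> is_stack [:: (p, TO)].
Proof. by move=> pC; apply/is_stack_TO; split=> //; exact: is_stack_nil. Qed.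

Lemma is_stack_behead t s : is_stack (t :: s) -> is_stack s.
Proof. by case: t => p [] => [/is_stack_TO []|/is_stack_TI []]. Qed.

Lemma is_stack_pair p s : is_stack [:: (p, TO), (p, TI) & s] ->
  [/\ isC p, is_stack s, seq_of s = 1 & p \notin names s].
Proof. by case/is_stack_TO => _ /is_stack_TI. Qed.

(** Alternating tags that end with an output: the excess of outputs is 1 or 0 according to the first
    tag. Counts add up over interleavings, hence so does [seq_of]. *)
Lemma stack_count s : is_stack s ->
  count (fun t => t.2 == TO) s = count (fun t => t.2 == TI) s + seq_of s.
Proof.
elim: s => //= -[p []] s IH.
  by case/is_stack_TO => _ /IH -> -> _ _; rewrite add0n addn0 addnC.
by case/is_stack_TI => _ /IH -> -> _; rewrite addn0 add0n addnC.
Qed.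

(** * Interleavings *)

Lemma shuffleC (T : Type) (s s1 s2 : seq T) : shuffle s s1 s2 -> shuffle s s2 s1.
Proof. by elim=> *; constructor. Qed.

Lemma shuffle_map (T T' : Type) (f : T -> T') (s s1 s2 : seq T) :
  shuffle s s1 s2 -> shuffle (map f s) (map f s1) (map f s2).
Proof. by elim=> *; constructor. Qed.

Lemma shuffle_perm (T : eqType) (s s1 s2 : seq T) :
  shuffle s s1 s2 -> perm_eq s (s1 ++ s2).
Proof.
elim=> //= t r r1 r2 _ IH; last by rewrite perm_cons.
by rewrite -cat1s -[t :: r2]cat1s perm_sym perm_catCA perm_cat2l perm_sym.
Qed.

Lemma shuffle_mem (T : eqType) (s s1 s2 : seq T) :
  shuffle s s1 s2 -> s =i s1 ++ s2.
Proof. by move/shuffle_perm/perm_mem. Qed.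

Lemma shuffle_uniq (T : eqType) (s s1 s2 : seq T) (t : T) :
  shuffle s s1 s2 -> uniq s -> t \in s1 -> t \notin s2.
Proof.
move/shuffle_perm/perm_uniq => ->; rewrite cat_uniq => /and3P [_ /hasPn H _] ts.
by apply: contraTN ts => /H.
Qed.

Lemma shuffle_consE (T : Type) (t : T) (s s1 s2 : seq T) : shuffle (t :: s) s1 s2 ->
  (exists2 s1', s1 = t :: s1' & shuffle s s1' s2) \/
  (exists2 s2', s2 = t :: s2' & shuffle s s1 s2').
Proof.
by move=> H; inversion H as [|? ? ? s3 H' | ? ? s3 ? H']; subst;
  [right|left]; exists s3.
Qed.

Lemma shuffle_cons_memE (T : eqType) (t : T) (s s1 s2 : seq T) :
  uniq (t :: s) -> shuffle (t :: s) s1 s2 -> t \in s1 ->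
  exists2 s1', s1 = t :: s1' & shuffle s s1' s2.
Proof.
move=> U sh t1; case: (shuffle_consE sh) => // -[s2' E _].
by have := shuffle_uniq sh U t1; rewrite E mem_head.
Qed.

Lemma shuffle_seq_of s s1 s2 : is_stack s -> is_stack s1 -> is_stack s2 ->
  shuffle s s1 s2 -> seq_of s = seq_of s1 + seq_of s2.
Proof.
move=> h h1 h2 /shuffle_perm /permP E.
have := stack_count h; rewrite !E !count_cat (stack_count h1) (stack_count h2).
rewrite addnACA => /eqP; by rewrite eqn_add2l => /eqP <-.
Qed.

Lemma seq_of_le1 s : seq_of s <= 1.
Proof. by case: s => // -[p []]. Qed.

(** Since [seq_of] is additive and at most 1, the other component cannot start with an output. The
    whole stack does start with one, and only the first component can supply it. *)
Lemma shuffle_TO_head p s1' s s2 :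
  is_stack s -> is_stack ((p, TO) :: s1') -> is_stack s2 ->
  shuffle s ((p, TO) :: s1') s2 ->
  seq_of s2 = 0 /\ exists2 s', s = (p, TO) :: s' & shuffle s' s1' s2.
Proof.
move=> h h1 h2 sh; have E := shuffle_seq_of h h1 h2 sh.
have s20 : seq_of s2 = 0.
  by apply/eqP; have := seq_of_le1 s; rewrite E /= ltnS leqn0.
split=> //; move: E sh; rewrite s20 /=; case: s h => // t s h E sh.
case: (shuffle_consE sh) => -[r]; first by move=> [? ?]; subst; exists s.
by move=> E2; subst s2; case: t E s20 {h sh h2} => ? [].
Qed.

(** * Removing an adjacent pair from a stack *)

Lemma stack_split_TO xi p s : is_stack (xi ++ (p, TO) :: s) ->
  xi = [::] \/ exists xi' q, xi = rcons xi' (q, TI).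
Proof.
case/lastP: xi => [|xi [q b]]; first by left.
rewrite cat_rcons; case: b => H; last by right; exists xi, q.
exfalso; elim: xi H => [/is_stack_TO [] //|t xi IH /is_stack_behead //].
Qed.

Lemma stack_cut_seq_of xi p s : is_stack (xi ++ [:: (p, TO), (p, TI) & s]) ->
  seq_of (xi ++ s) = seq_of (xi ++ [:: (p, TO), (p, TI) & s]).
Proof. by case: xi => [/is_stack_pair []|]. Qed.

Lemma stack_cut xi p s : is_stack (xi ++ [:: (p, TO), (p, TI) & s]) ->
  [/\ isC p, is_stack (xi ++ s), seq_of s = 1 & p \notin names (xi ++ s)].
Proof.
elim: xi => [/is_stack_pair //|[q b] xi IH] /= H.
have hq := stack_cut_seq_of (is_stack_behead H).
have [pC h s1 pN] := IH (is_stack_behead H).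
have mem t : t \in xi ++ s -> t \in xi ++ [:: (p, TO), (p, TI) & s].
  by rewrite !mem_cat !inE => /orP [->|->]; rewrite ?orbT.
have pmem b' : (p, b') \in xi ++ [:: (p, TO), (p, TI) & s].
  by rewrite mem_cat !inE; case: b'; rewrite eqxx ?orbT.
split=> //.
  case: b H => [/is_stack_TO [qC _ q0 qN hd]|/is_stack_TI [qC _ q1 qN]].
    apply/is_stack_TO; split=> //; [by rewrite hq|exact: contra (mem _) _|].
    move=> /mem /hd [s' E]; case: xi E q0 {IH hq h pN mem pmem qN hd} => //= t xi.
    by move=> [<- _] _; exists (xi ++ s).
  apply/is_stack_TI; split=> //; first by rewrite hq.
  by apply: contra qN => /mapP [t /mem tm ->]; exact: map_f.
rewrite inE negb_or pN andbT; apply/eqP => E; rewrite -{q}E in H.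
case: b H => [/is_stack_TO [_ _ _ /negP []]|/is_stack_TI [_ _ _ /negP []]] //.
exact: (map_f fst (pmem TO)).
Qed.

(** Lets a push on the stack outside a restriction be replayed inside it, where the pair of the
    bound name is still present. *)
Lemma stack_cut_TO q xi p s : q != p ->
  is_stack (xi ++ [:: (p, TO), (p, TI) & s]) -> is_stack ((q, TO) :: xi ++ s) ->
  is_stack ((q, TO) :: xi ++ [:: (p, TO), (p, TI) & s]).
Proof.
move=> qp h /is_stack_TO [qC _ q0 qN hd]; have [_ _ s1 _] := stack_cut h.
have memE b : ((q, b) \in xi ++ [:: (p, TO), (p, TI) & s]) = ((q, b) \in xi ++ s).
  by rewrite !mem_cat !inE !xpair_eqE (negPf qp).
apply/is_stack_TO; split; rewrite ?memE -?stack_cut_seq_of //.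
(* With [xi] empty, q^I would head [s], which starts with an output; otherwise q^I heads [xi] and
   stays next to q^O. *)
move=> /hd [s' E]; case: xi E q0 {h qN hd memE} => [/= Es|t xi /= [-> _] _].
  by rewrite s1.
by exists (xi ++ [:: (p, TO), (p, TI) & s]).
Qed.

Lemma infix_map (T T' : eqType) (f : T -> T') (s1 s : seq T) :
  infix s1 s -> infix (map f s1) (map f s).
Proof.
by case/infixP => l [r ->]; apply/infixP; exists (map f l), (map f r); rewrite !map_cat.
Qed.

End Stacks.

(** * Typing, free names and renaming *)

Section Typing.
Context {S : sorting}.
Implicit Types (a b c p q : name S) (bs cs : seq (name S)).
Implicit Types (P Q : proc S) (f g : name S -> name S) (s xi : seq (tname S)).

Definition map_stack f s : seq (tname S) := [seq (f t.1, t.2) | t <- s].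

Lemma names_map_stack f s : names (map_stack f s) = map f (names s).
Proof. by rewrite /names /map_stack -!map_comp. Qed.

Lemma eq_in_map_stack f g s :
  {in names s, f =1 g} -> map_stack f s = map_stack g s.
Proof. by move=> E; apply/eq_in_map => t /(map_f fst) /E /= ->. Qed.

Lemma map_stack_fix f s : {in names s, f =1 id} -> map_stack f s = s.
Proof.
by move=> E; rewrite -[RHS]map_id; apply/eq_in_map => -[p t] /(map_f fst) /E /= ->.
Qed.

Lemma map_stack_is_stack f s : (forall a, nsort (f a) = nsort a) ->
  {in names s &, injective f} -> is_stack s -> is_stack (map_stack f s).
Proof.
move=> fS fI [sC alt lst U nxt].
have nm p t : (p, t) \in s -> p \in names s by move/(map_f fst).
split.
- rewrite names_map_stack all_map; apply: sub_all sC => a /=.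
  by rewrite (isC_sort (fS a)).
- by rewrite sorted_map.
- by rewrite -map_comp.
- rewrite map_inj_in_uniq // => -[p t] [p' t'] /nm ps /nm ps' [E ->].
  by rewrite (fI _ _ ps ps' E).
- move=> _ /mapP [[p []] // pO [->]] /mapP [[q []] // qI [E]].
  have Epq := fI _ _ (nm _ _ pO) (nm _ _ qI) E; subst q.
  exact: (infix_map (fun t => (f t.1, t.2)) (nxt p pO qI)).
Qed.

Lemma wb_typed_is_stack s P : wb_typed s P -> is_stack s.
Proof.
elim=> {s P}; do ?by move=> *; first [exact: is_stack_nil | exact: is_stack_seq1 | assumption].
- move=> q bs p P qC _ _ pC pq _ h; apply/is_stack_TI; split=> //.
  by rewrite inE eq_sym.
- by move=> xi p s P _ _ _ /stack_cut [].
- by move=> s s1 s2 P Q _ _ _ _ [].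
Qed.

(** The stack records exactly the free continuation names. This turns the test on [fn P'] in the
    rule for internal steps into a question about stacks. *)
Lemma wb_typed_mem_fn s P p : wb_typed s P -> isC p ->
  (p \in fn P) = (p \in names s).
Proof.
move=> h pC; elim: h => {s P}.
- by move=> q bs qC bsA; rewrite mem_fn_out !inE (negPf (allA_notin pC bsA)) orbF.
- move=> x bs q xO bsA qC.
  rewrite mem_fn_out inE mem_rcons !inE (negPf (allA_notin pC bsA)) orbF.
  by rewrite eq_sym (negPf (isA_isC_neq (isO_isA xO) pC)).
- move=> u bs uI bsA; rewrite mem_fn_out inE (negPf (allA_notin pC bsA)) orbF.
  by rewrite eq_sym (negPf (isA_isC_neq (isI_isA uI) pC)).
- move=> q bs r P qC bsA _ rC _ _ /= IH.
  by rewrite inE mem_fn_close IH (negPf (allA_notin pC bsA)) andbT !inE.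
- move=> x bs r P xO bsA _ rC _ /= IH.
  rewrite inE mem_fn_close IH mem_rcons !inE (negPf (allA_notin pC bsA)) orbF andbN.
  by rewrite eq_sym (negPf (isA_isC_neq (isO_isA xO) pC)).
- move=> x bs r P xO bsA _ rC _ /= IH.
  rewrite inE mem_fn_close IH mem_rcons !inE (negPf (allA_notin pC bsA)) orbF andbN.
  by rewrite eq_sym (negPf (isA_isC_neq (isO_isA xO) pC)).
- move=> u bs r P uI bsA _ rC _ /= IH.
  rewrite inE mem_fn_close IH (negPf (allA_notin pC bsA)) andbT.
  by rewrite eq_sym (negPf (isA_isC_neq (isI_isA uI) pC)).
- by [].
- move=> xi q s P qC _ h IH /=; rewrite mem_fn_close IH inE.
  have [_ _ _] := stack_cut (wb_typed_is_stack h).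
  rewrite /names !map_cat !mem_cat /= !inE; have [->|_] := eqVneq p q => /=.
    by rewrite andbF => /negPf ->.
  by rewrite andbT.
- move=> s q P qC qN h IH /=; rewrite mem_fn_close IH inE.
  by have [->|] := eqVneq p q; rewrite ?(negPf qN) // andbT.
- move=> s a P aA h IH /=; rewrite mem_fn_close IH inE.
  by rewrite eq_sym (negPf (isA_isC_neq aA pC)) andbT.
- move=> a b G aA bA h /= IH; rewrite !inE IH.
  by rewrite !(eq_sym p) (negPf (isA_isC_neq aA pC)) (negPf (isA_isC_neq bA pC)).
- move=> s s1 s2 P Q _ IHP _ IHQ [_ sh] /=.
  rewrite mem_cat IHP IHQ /names -mem_cat -map_cat.
  by rewrite (eq_mem_map _ (shuffle_mem sh)).
- by [].
- by move=> s G G' _ _ IH _ IH' /=; rewrite mem_cat IH IH' orbb.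
Qed.

Lemma isC_names s P p : wb_typed s P -> p \in names s -> isC p.
Proof. by move/wb_typed_is_stack => [/allP + _ _ _ _] ps; exact. Qed.

Lemma names_sub_fn s P : wb_typed s P -> {subset names s <= fn P}.
Proof. by move=> h p ps; rewrite (wb_typed_mem_fn h) // (isC_names h). Qed.

(** The side conditions of [wb_nuC] are automatic: what precedes p^O in a stack is empty or ends
    with an input tag. *)
Lemma wb_nuC_cut xi p s P :
  wb_typed (xi ++ [:: (p, TO), (p, TI) & s]) P -> wb_typed (xi ++ s) (nu p P).
Proof.
move=> h; have k := wb_typed_is_stack h; have [pC _ _ _] := stack_cut k.
apply: wb_nuC h => //; exact: stack_split_TO k.
Qed.

(** Moves a renaming under a binder, with bound names avoiding any prescribed list [L]; [f'] is [f]
    redirected on [bs] to the new names. *)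
Lemma ren_close_fresh f bs P (L : seq (name S)) : (forall a, nsort (f a) = nsort a) ->
  exists bs', let f' := fun a => nth (f a) bs' (index a bs) in
  size bs' = size bs /\
  [/\ map (@nsort S) bs' = map (@nsort S) bs, uniq bs',
      forall a, a \in L -> a \notin bs',
      forall a, nsort (f' a) = nsort a
    & ren f (close 0 bs P) = close 0 bs' (ren f' P)].
Proof.
move=> fS; have [sz E U fr] := fresh_namesP (L ++ map f (fn P)) bs.
exists (fresh_names (L ++ map f (fn P)) bs); split=> //; split=> //.
- by move=> a aL; apply: fr; rewrite mem_cat aL.
- move=> a; have [ab|ab] := boolP (a \in bs); last first.
    by rewrite nth_default ?fS // memNindex // sz.
  have ib : index a bs < size bs by rewrite index_mem.
  by rewrite -(nth_map _ (nsort a)) ?sz // E (nth_map a) // nth_index.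
- apply: ren_close => // a aP _; apply: fr; by rewrite mem_cat map_f ?orbT.
Qed.

Lemma nth_index_notin f bs bs' a : size bs' = size bs -> a \notin bs ->
  nth (f a) bs' (index a bs) = f a.
Proof. by move=> sz ab; rewrite nth_default // memNindex // sz. Qed.

Lemma nth_index_rcons a bs cs p q : size cs = size bs -> p \notin bs ->
  nth a (rcons cs q) (index p (rcons bs p)) = q.
Proof.
move=> sz pN; rewrite -(cats1 bs) index_cat (negPf pN) /= eqxx addn0 -sz.
by rewrite nth_rcons ltnn eqxx.
Qed.

(* Injectivity is needed on continuation names only; the typing rules do not
   distinguish the other names. *)
Lemma wb_typed_ren f s P : (forall a, nsort (f a) = nsort a) ->
  {in names s &, injective f} -> wb_typed s P -> wb_typed (map_stack f s) (ren f P).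
Proof.
move=> fS fI h.
have alA g (gS : forall a, nsort (g a) = nsort a) bs :
    all (@isA S) bs -> all (@isA S) (map g bs).
  by rewrite all_map => /sub_all; apply=> a /=; rewrite (isA_sort (gS a)).
(* Bodies of inputs have one-entry stacks, so injectivity costs nothing there. *)
have inj1 g p : {in names [:: (p, TO) : tname S] &, injective g}.
  by move=> a b; rewrite !inE => /eqP -> /eqP ->.
elim: h f fS fI => {s P}.
- move=> p bs pC bsA f fS _; rewrite ren_out.
  by apply: wb_outC; [rewrite (isC_sort (fS p))|apply: alA].
- move=> x bs p xO bsA pC f fS _; rewrite ren_out map_rcons.
  apply: wb_outO; rewrite ?(isC_sort (fS p)) ?(isO_sort (fS x)) //; exact: alA.
- move=> u bs uI bsA f fS _; rewrite ren_out.
  by apply: wb_outI; [rewrite (isI_sort (fS u))|apply: alA].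
- move=> q bs p P qC bsA U pC pq h IH f fS fI /=.
  have [bs' /= [sz [E U' _ f'S ->]]] := ren_close_fresh bs P [::] fS.
  rewrite -E; apply: wb_inC; rewrite ?(isC_sort (fS _)) ?(all_isA_sort E) //.
    by apply: contraNneq pq => /fI ->; rewrite ?inE ?eqxx ?orbT.
  rewrite -(nth_index_notin f sz (allA_notin pC bsA)).
  exact: (IH _ f'S (inj1 _ _)).
- move=> x bs p P xO bsA U pC h IH f fS _ /=.
  have [bs' /= [sz [E U' _ f'S ->]]] := ren_close_fresh (rcons bs p) P [::] fS.
  rewrite -E; have [cs [q [Ebs' E' Eq]]] := map_rconsP E; subst bs'.
  have Eqf : nth (f p) (rcons cs q) (index p (rcons bs p)) = q.
    by apply: nth_index_rcons (allA_notin pC bsA); move/(congr1 size): E'; rewrite !size_map.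
  apply: wb_inO; rewrite ?(isO_sort (fS _)) ?(all_isA_sort E') ?(isC_sort Eq) //.
    by move: U'; rewrite rcons_uniq => /andP [].
  by have := IH _ f'S (inj1 _ _); rewrite /map_stack /= Eqf.
- move=> x bs p P xO bsA U pC h IH f fS _ /=.
  have [bs' /= [sz [E U' _ f'S ->]]] := ren_close_fresh (rcons bs p) P [::] fS.
  rewrite -E; have [cs [q [Ebs' E' Eq]]] := map_rconsP E; subst bs'.
  have Eqf : nth (f p) (rcons cs q) (index p (rcons bs p)) = q.
    by apply: nth_index_rcons (allA_notin pC bsA); move/(congr1 size): E'; rewrite !size_map.
  apply: wb_rep; rewrite ?(isO_sort (fS _)) ?(all_isA_sort E') ?(isC_sort Eq) //.
    by move: U'; rewrite rcons_uniq => /andP [].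
  by have := IH _ f'S (inj1 _ _); rewrite /map_stack /= Eqf.
- move=> u bs p P uI bsA U pC h IH f fS fI /=.
  have [bs' /= [sz [E U' _ f'S ->]]] := ren_close_fresh bs P [::] fS.
  rewrite -E; apply: wb_inI;
    rewrite ?(isC_sort (fS _)) ?(isI_sort (fS _)) ?(all_isA_sort E) //.
  rewrite -(nth_index_notin f sz (allA_notin pC bsA)).
  exact: (IH _ f'S (inj1 _ _)).
- by move=> *; apply: wb_nil.
- move=> xi p s P pC _ h IH f fS fI /=.
  have [_ k _ pN] := stack_cut (wb_typed_is_stack h).
  (* The new bound name avoids the images of the outer stack, which keeps [f'] injective on the
     larger stack containing the pair. *)
  have [bs' /= [sz [E U' fr f'S ->]]] :=
    ren_close_fresh [:: p] P (map f (names (xi ++ s))) fS.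
  case: bs' sz E fr f'S {U'} => [|p' [|? ?]] //= _ [E] fr f'S.
  rewrite -E; set f' := (fun a => nth _ _ _) in f'S *.
  have f'E a : a \in names (xi ++ s) -> f' a = f a.
    move=> am; rewrite /f' /=; case: eqP => // pa; by rewrite -pa (negPf pN) in am.
  have f'p : f' p = p' by rewrite /f' /= eqxx.
  have nE a : a \in names (xi ++ [:: (p, TO), (p, TI) & s]) =
      (a == p) || (a \in names (xi ++ s)).
    rewrite /names !map_cat !mem_cat /= !inE.
    by case: (a == p); rewrite ?orbT.
  have -> : map_stack f (xi ++ s) = map_stack f' xi ++ map_stack f' s.
    by rewrite -map_cat; apply: eq_in_map_stack => a /f'E.
  apply: wb_nuC_cut.
  have := IH f' f'S; rewrite /map_stack map_cat /= f'p; apply.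
  have neq b : b \in names (xi ++ s) -> f' b != p'.
    move=> bm; rewrite f'E //; have := fr (f b); rewrite map_f // inE.
    exact.
  move=> a b; rewrite !nE => /orP [/eqP ->|am] /orP [/eqP ->|bm] //.
  + by rewrite f'p => /esym /eqP; rewrite (negPf (neq _ bm)).
  + by rewrite f'p => /eqP; rewrite (negPf (neq _ am)).
  + by rewrite !f'E //; apply: fI.
- move=> s p P pC pN h IH f fS fI /=.
  have [bs' /= [sz [E U' fr f'S ->]]] :=
    ren_close_fresh [:: p] P (map f (names s)) fS.
  case: bs' sz E fr f'S {U'} => [|p' [|? ?]] //= _ [E] fr f'S.
  rewrite -E; set f' := (fun a => nth _ _ _) in f'S *.
  have f'E a : a \in names s -> f' a = f a.
    move=> am; rewrite /f' /=; case: eqP => // pa; by rewrite -pa (negPf pN) in am.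
  apply: wb_nuC'; first by rewrite (isC_sort E).
    apply/negP; rewrite names_map_stack => /fr; by rewrite mem_head.
  rewrite -(@eq_in_map_stack f') //; apply: IH => // a b am bm.
  by rewrite !f'E //; apply: fI.
- move=> s p P pA h IH f fS fI /=.
  have pN : p \notin names s by apply: contraTN pA => /(isC_names h); rewrite /isA => ->.
  have [bs' /= [sz [E U' fr f'S ->]]] :=
    ren_close_fresh [:: p] P (map f (names s)) fS.
  case: bs' sz E fr f'S {U'} => [|p' [|? ?]] //= _ [E] fr f'S.
  rewrite -E; set f' := (fun a => nth _ _ _) in f'S *.
  have f'E a : a \in names s -> f' a = f a.
    move=> am; rewrite /f' /=; case: eqP => // pa; by rewrite -pa (negPf pN) in am.
  apply: wb_nuA; first by rewrite (isA_sort E).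
  rewrite -(@eq_in_map_stack f') //; apply: IH => // a b am bm.
  by rewrite !f'E //; apply: fI.
- move=> a b G aA bA h IH f fS fI /=.
  by apply: wb_match; rewrite ?(isA_sort (fS _)) //; apply: IH.
- move=> s s1 s2 P Q _ IHP _ IHQ [k sh] f fS fI /=.
  have sub a : a \in names s1 ++ names s2 -> a \in names s.
    by rewrite -map_cat /names (eq_mem_map _ (shuffle_mem sh)).
  apply: (@wb_par _ _ (map_stack f s1) (map_stack f s2)).
  + apply: IHP => // a b am bm; apply: fI; apply: sub; by rewrite mem_cat ?am ?bm.
  + apply: IHQ => // a b am bm; apply: fI; apply: sub;
      by rewrite mem_cat ?am ?bm orbT.
  + by split; [exact: map_stack_is_stack | exact: shuffle_map].
- move=> s P sz h IH f fS fI /=; apply: wb_tau; first by rewrite size_map.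
  exact: IH.
- move=> s G G' sz h IH h' IH' f fS fI /=; apply: wb_sum; first by rewrite size_map.
    exact: IH.
  exact: IH'.
Qed.

(** * Inversion of typing under binders *)

Lemma close_psubst bs bs' cs P Q : close 0 bs P = close 0 bs' Q ->
  size cs = size bs -> size cs = size bs' -> psubst bs cs P = psubst bs' cs Q.
Proof. by move=> E sz sz'; rewrite -(open_close P sz 0) E open_close. Qed.

Lemma psubst_sort bs cs a : map (@nsort S) cs = map (@nsort S) bs ->
  nsort (nth a cs (index a bs)) = nsort a.
Proof.
elim: bs cs => [|b bs IH] [|c cs] //= [E1 E2].
by case: eqP => [<-|_] //=; apply: IH.
Qed.

(** An early input may identify names; on a one-entry stack this does no harm. *)
Lemma wb_typed_psubst p P bs cs : map (@nsort S) cs = map (@nsort S) bs ->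
  wb_typed [:: (p, TO)] P ->
  wb_typed [:: (nth p cs (index p bs), TO)] (psubst bs cs P).
Proof.
move=> E h; apply: (wb_typed_ren _ _ h) => [a|a b]; first exact: psubst_sort.
by rewrite !inE => /eqP -> /eqP ->.
Qed.

(** A restriction fixes its body only up to the choice of the bound name. A typing of the
    presentation with [p] is carried to the one with [c] by the renaming [f]. *)
Lemma nu_inj c P p Q : nu c P = nu p Q ->
  let f := fun a => nth a [:: c] (index a [:: p]) in
  nsort c = nsort p /\ forall s, wb_typed s Q ->
    [/\ wb_typed (map_stack f s) P, f p = c
      & p \notin names s -> map_stack f s = s /\ c \notin names s].
Proof.
move=> [Es Ec] f; split=> // s h.
have EP : P = psubst [:: p] [:: c] Q.
  by rewrite -[LHS](psubst_id [:: c]); apply: close_psubst Ec _ _.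
(* [c] is not free in [nu c P], so it can be free in [Q] only as the bound name itself; hence [f]
   merges no two free names of [Q]. *)
have cQ : c \in fn Q -> c = p.
  move=> cQ; have := mem_fn_close [:: c] c P 0.
  by rewrite Ec mem_fn_close cQ !inE eqxx andbF /= => /negbFE /eqP.
have fE a : f a = if a == p then c else a.
  by rewrite /f /= eq_sym; case: eqP.
split; last 1 first.
- move=> pN; split; last first.
    apply/negP => cs; have := cQ (names_sub_fn h cs) => cp.
    by rewrite -cp cs in pN.
  apply: map_stack_fix => a am; by rewrite fE; case: eqP => // ap; rewrite -ap am in pN.
- rewrite EP; apply: wb_typed_ren (h) => [a|a b /(names_sub_fn h) aQ /(names_sub_fn h) bQ].
    by apply: psubst_sort; rewrite /= Es.
  rewrite -/(f a) -/(f b) !fE; case: eqP => [->|ap]; case: eqP => [->|bp] // E.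
    by case: bp; rewrite -E in bQ *; apply: cQ.
  by case: ap; rewrite E in aQ *; apply: cQ.
- by rewrite fE eqxx.
Qed.

(** Only two situations matter later: the restriction hides a pair of [c], or [c] is absent from the
    stack. The rule for other names falls under the second. *)
Lemma wb_nu_inv s c P : wb_typed s (nu c P) ->
  (exists xi s', s = xi ++ s' /\ wb_typed (xi ++ [:: (c, TO), (c, TI) & s']) P) \/
  (c \notin names s /\ wb_typed s P).
Proof.
move ER : (nu c P) => R h; case: h ER => // {s R}.
- move=> xi p s Q pC _ h /nu_inj; set f := (fun a => nth _ _ _).
  case=> _ /(_ _ h) [hP fp _].
  have [_ _ _ pN] := stack_cut (wb_typed_is_stack h).
  have fE a : a \in names (xi ++ s) -> f a = a.
    by rewrite /f /=; case: eqP => // <-; rewrite (negPf pN).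
  left; exists xi, s; split=> //; move: hP.
  rewrite /map_stack map_cat -/(map_stack f xi) !map_cons -/(map_stack f s) !fp.
  rewrite !map_stack_fix // => a am; apply: fE; rewrite /names map_cat mem_cat;
    by rewrite am ?orbT.
- move=> s p Q pC pN h /nu_inj [_ /(_ _ h) [hP _ /(_ pN) [E cN]]].
  by right; rewrite E in hP.
- move=> s p Q pA h /nu_inj [_ /(_ _ h) [hP _ H]].
  have pN : p \notin names s by apply: contraTN pA => /(isC_names h); rewrite /isA => ->.
  by right; case: (H pN) => E cN; rewrite E in hP.
Qed.

Lemma wb_nu_fresh s c P : c \notin names s -> wb_typed s P -> wb_typed s (nu c P).
Proof.
by move=> cN h; have [cC|cA] := boolP (isC c); [apply: wb_nuC'|apply: wb_nuA].
Qed.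

Lemma wb_par_inv s P Q : wb_typed s (PPar P Q) -> exists s1 s2,
  [/\ wb_typed s1 P, wb_typed s2 Q & interleaving s s1 s2].
Proof.
move ER : (PPar P Q) => R h; case: h ER => // r s1 s2 P0 Q0 h1 h2 i [-> ->].
by exists s1, s2.
Qed.

Lemma interleavingC s s1 s2 : interleaving s s1 s2 -> interleaving s s2 s1.
Proof. by case=> ? /shuffleC. Qed.

(** Reduces a move of the right component to one of the left. *)
Lemma wb_parC s P Q : wb_typed s (PPar P Q) -> wb_typed s (PPar Q P).
Proof.
by case/wb_par_inv => s1 [s2 [h1 h2 /interleavingC i]]; apply: wb_par h2 h1 i.
Qed.

(** * Effect of a transition on the stack *)

(** In [OutSpecExtr] the opened restriction hid p^O, p^I on top of [s]: the output uses up p^O and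
    leaves p^I exposed. The clause [seq_of s = 1] remembers what followed that pair. *)
Variant out_spec s cs a bs P' : Prop :=
| OutSpecC s' of isC a & all (@isA S) bs & s = (a, TO) :: s' & wb_typed s' P'
| OutSpecFree (b : seq (name S)) p s' of isO a & bs = rcons b p & all (@isA S) b & isC p
    & p \notin cs & s = (p, TO) :: s' & wb_typed s' P'
| OutSpecExtr (b : seq (name S)) p of isO a & bs = rcons b p & all (@isA S) b & isC p
    & p \in cs & seq_of s = 1 & wb_typed ((p, TI) :: s) P'
| OutSpecI of isI a & all (@isA S) bs & wb_typed s P'.

Arguments OutSpecC {s cs a bs P' s'}.
Arguments OutSpecI {s cs a bs P'}.

(* An early input may receive a continuation name that cannot be pushed on s,
   hence the guard in InSpecO. *)
Variant in_spec s a bs P' : Prop :=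
| InSpecC of isC a & all (@isA S) bs & (a, TI) \in s
    & (forall s', s = (a, TI) :: s' -> wb_typed s' P')
| InSpecO (b : seq (name S)) p of isO a & bs = rcons b p & all (@isA S) b & isC p
    & (is_stack ((p, TO) :: s) -> wb_typed ((p, TO) :: s) P')
| InSpecI of isI a & all (@isA S) bs & wb_typed s P'.

(** The second alternative comes from a communication at the free continuation name q, in which both
    tags of q disappear. *)
Definition tau_spec s P' : Prop := wb_typed s P' \/
  exists q s', s = [:: (q, TO), (q, TI) & s'] /\ wb_typed s' P'.

Lemma out_spec_mono s cs a bs P Q : (forall r, wb_typed r P -> wb_typed r Q) ->
  out_spec s cs a bs P -> out_spec s cs a bs Q.
Proof.
move=> PQ [s' aC bsA E /PQ h|b p s' aO E bA pC pN Es /PQ h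
  |b p aO E bA pC pcs s1 /PQ h|aI bsA /PQ h];
  [exact: OutSpecC aC bsA E h|exact: OutSpecFree aO E bA pC pN Es h
  |exact: OutSpecExtr aO E bA pC pcs s1 h|exact: OutSpecI].
Qed.

Lemma in_spec_mono s a bs P Q : (forall r, wb_typed r P -> wb_typed r Q) ->
  in_spec s a bs P -> in_spec s a bs Q.
Proof.
move=> PQ [aC bsA aI h|b p aO E bA pC h|aI bsA /PQ h];
  [apply: InSpecC|apply: (InSpecO aO E)|exact: InSpecI] => //;
  by move=> *; apply: PQ; apply: h.
Qed.

Lemma tau_spec_mono s P Q : (forall r, wb_typed r P -> wb_typed r Q) ->
  tau_spec s P -> tau_spec s Q.
Proof. by move=> PQ [/PQ|[q [s' [E /PQ]]]]; [left|right; exists q, s']. Qed.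

Lemma out_spec_par s s1 s2 cs a bs P Q : out_spec s1 cs a bs P ->
  is_stack s1 -> wb_typed s2 Q -> interleaving s s1 s2 -> disj cs (fn Q) ->
  out_spec s cs a bs (PPar P Q).
Proof.
move=> H k1 hQ [k sh] dj; have k2 := wb_typed_is_stack hQ.
case: H => [s' aC bsA E h|b p s' aO E bA pC pN Es h
  |b p aO E bA pC pcs s11 h|aI bsA h].
- subst s1; have [_ [s0 Es sh']] := shuffle_TO_head k k1 k2 sh; subst s.
  by apply: (OutSpecC _ _ erefl) => //; apply: wb_par h hQ _; split=> //;
    apply: is_stack_behead k.
- subst s1; have [_ [s0 Es sh']] := shuffle_TO_head k k1 k2 sh; subst s.
  by apply: (OutSpecFree aO E bA pC pN erefl); apply: wb_par h hQ _; split=> //;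
    apply: is_stack_behead k.
- have s_1 : seq_of s = 1.
    apply/eqP; rewrite eqn_leq seq_of_le1 (shuffle_seq_of k k1 k2 sh) s11.
    exact: leq_addr.
  apply: (OutSpecExtr aO E bA pC pcs s_1); apply: wb_par (h) (hQ) _; split; last first.
    exact: sh_l.
  apply/is_stack_TI; split=> //.
  rewrite /names (eq_mem_map _ (shuffle_mem sh)) map_cat mem_cat negb_or.
  have /is_stack_TI [_ _ _ ->] := wb_typed_is_stack h.
  (* The extruded name is not free in [Q], hence absent from its stack. *)
  apply/negP => p2; move/hasPn: dj => /(_ p pcs).
  by rewrite /= (names_sub_fn hQ).
- by apply: OutSpecI => //; apply: wb_par h hQ _.
Qed.

(** Guards descend from [s] to [s1]. An entry of [s1] that heads [s] also heads [s1], by uniqueness;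
    and if p^O can be pushed on [s], then [seq_of s1 = 0] by additivity, and p^I, if in [s1], heads
    it. *)
Lemma in_spec_par s s1 s2 a bs P Q : in_spec s1 a bs P ->
  is_stack s1 -> wb_typed s2 Q -> interleaving s s1 s2 ->
  in_spec s a bs (PPar P Q).
Proof.
move=> H k1 hQ [k sh]; have k2 := wb_typed_is_stack hQ.
case: H => [aC bsA ai h|b p aO E bA pC h|aI bsA h].
- apply: InSpecC => //; first by rewrite (shuffle_mem sh) mem_cat ai.
  move=> s' Es; subst s.
  have [s1' E1 sh'] := shuffle_cons_memE (stack_uniq k) sh ai.
  by apply: wb_par (h _ E1) hQ _; split=> //; apply: is_stack_behead k.
- apply: (InSpecO aO E) => // kp; apply: wb_par hQ _; last first.
    by split=> //; apply: sh_l sh.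
  apply: h; case/is_stack_TO: (kp) => _ _ s0 pN hd.
  apply/is_stack_TO; split=> //.
  + by apply/eqP; have := shuffle_seq_of k k1 k2 sh; rewrite s0; case: seq_of.
  + by apply: contra pN; rewrite (shuffle_mem sh) mem_cat => ->.
  + move=> p1; have ps : (p, TI) \in s by rewrite (shuffle_mem sh) mem_cat p1.
    have [s' Es] := hd ps; subst s.
    by have [s1' E1 _] := shuffle_cons_memE (stack_uniq k) sh p1; exists s1'.
- by apply: InSpecI => //; apply: wb_par h hQ _.
Qed.

Lemma tau_spec_par s s1 s2 P Q : tau_spec s1 P ->
  is_stack s1 -> wb_typed s2 Q -> interleaving s s1 s2 ->
  tau_spec s (PPar P Q).
Proof.
move=> H k1 hQ [k sh]; have k2 := wb_typed_is_stack hQ.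
case: H => [h|[q [s' [E h]]]]; first by left; apply: wb_par h hQ _.
right; subst s1; have [s20 [s0 Es sh']] := shuffle_TO_head k k1 k2 sh; subst s.
(* The stack condition on [s] forbids any entry of [s2] between q^O and q^I. *)
have [_ k0 _ _ hd] := (is_stack_TO q s0).1 k.
have [|r Er] := hd; first by rewrite (shuffle_mem sh') mem_head.
subst s0; exists q, r; split=> //.
have [s1' [<-] sh''] := shuffle_cons_memE (stack_uniq k0) sh' (mem_head _ _).
by apply: wb_par h hQ _; split=> //; apply: is_stack_behead k0.
Qed.

Lemma out_spec_nu s cs a bs c P P' : wb_typed s (nu c P) ->
  (forall r, wb_typed r P -> out_spec r cs a bs P') ->
  c \notin nm_label (LOut cs a bs) -> out_spec s cs a bs (nu c P').
Proof.
move=> hnu IH /=; rewrite mem_cat inE !negb_or => /and3P [cN ca cbs].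
case: (wb_nu_inv hnu) => [[xi [s0 [-> hP]]]|[cs' hP]].
  have k := wb_typed_is_stack hP; have [cC _ s01 _] := stack_cut k.
  case: (IH _ hP) => [s' aC bsA E h|b p s' aO E bA pC pN Es h
    |b p aO E bA pC pcs s11 h|aI bsA h].
  (* The head entry is not c^O because the label avoids [c], so the hidden pair lies below it and
     survives the pop. *)
  - case: xi E {hP k} => [[E]|t xi /= [-> E]]; first by rewrite E eqxx in ca.
    by subst s'; apply: OutSpecC (wb_nuC_cut h).
  - case: xi Es {hP k} => [[Es]|t xi /= [-> Es]].
      by rewrite E mem_rcons inE Es eqxx in cbs.
    by subst s'; apply: (OutSpecFree aO E bA pC pN erefl); apply: wb_nuC_cut h.
  - apply: (OutSpecExtr aO E bA pC pcs); first by rewrite (stack_cut_seq_of k).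
    exact: (wb_nuC_cut (xi := (p, TI) :: xi)).
  - by apply: OutSpecI => //; apply: wb_nuC_cut.
case: (IH _ hP) => [s' aC bsA E h|b p s' aO E bA pC pN Es h
    |b p aO E bA pC pcs s11 h|aI bsA h].
- apply: (OutSpecC aC bsA E); apply: wb_nu_fresh h.
  by apply: contra cs'; rewrite E inE orbC => ->.
- apply: (OutSpecFree aO E bA pC pN Es); apply: wb_nu_fresh h.
  by apply: contra cs'; rewrite Es inE orbC => ->.
- apply: (OutSpecExtr aO E bA pC pcs s11); apply: wb_nu_fresh h.
  rewrite inE negb_or cs' andbT; apply: contraNneq cbs => ->.
  by rewrite E mem_rcons mem_head.
- by apply: OutSpecI => //; apply: wb_nu_fresh.
Qed.

Lemma in_spec_nu s a bs c P P' : wb_typed s (nu c P) ->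
  (forall r, wb_typed r P -> in_spec r a bs P') ->
  c \notin nm_label (LIn a bs) -> in_spec s a bs (nu c P').
Proof.
move=> hnu IH /=; rewrite inE negb_or => /andP [ca cbs].
case: (wb_nu_inv hnu) => [[xi [s0 [-> hP]]]|[cs' hP]].
  have k := wb_typed_is_stack hP; have [cC _ s01 _] := stack_cut k.
  case: (IH _ hP) => [aC bsA ai h|b p aO E bA pC h|aI bsA h].
  - apply: InSpecC => //.
      by move: ai; rewrite !mem_cat !inE !xpair_eqE (eq_sym a) (negPf ca).
    case: xi h {hP k ai} => [_ s' /= E|t xi h s' /= [E <-]].
      by rewrite E in s01.
    by apply: wb_nuC_cut; apply: h; rewrite /= E.
  - apply: (InSpecO aO E) => // kp; apply: (wb_nuC_cut (xi := (p, TO) :: xi)).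
    apply: h; apply: stack_cut_TO => //; apply: contraNneq cbs => <-.
    by rewrite E mem_rcons mem_head.
  - by apply: InSpecI => //; apply: wb_nuC_cut.
case: (IH _ hP) => [aC bsA ai h|b p aO E bA pC h|aI bsA h].
- apply: InSpecC => // s' E; apply: wb_nu_fresh (h _ E).
  by apply: contra cs'; rewrite E inE orbC => ->.
- apply: (InSpecO aO E) => // kp; apply: wb_nu_fresh (h kp).
  rewrite inE negb_or cs' andbT; apply: contraNneq cbs => ->.
  by rewrite E mem_rcons mem_head.
- by apply: InSpecI => //; apply: wb_nu_fresh.
Qed.

Lemma tau_spec_nu s c P P' : wb_typed s (nu c P) ->
  (forall r, wb_typed r P -> tau_spec r P') -> tau_spec s (nu c P').
Proof.
move=> hnu IH; case: (wb_nu_inv hnu) => [[xi [s0 [-> hP]]]|[cs' hP]].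
  have k := wb_typed_is_stack hP; have [cC _ s01 cN] := stack_cut k.
  case: (IH _ hP) => [h|[q [s' [E h]]]]; first by left; apply: wb_nuC_cut.
  (* Either the removed pair is the hidden one, and [c] is now absent, or it lies inside [xi]. A
     one-entry [xi] would put c^O in the place of q^I. *)
  case: xi E cN {hP k} => [/= [_ _ E] cN|t [|t' xi] //= [-> -> E] cN].
  - by left; subst s'; apply: wb_nu_fresh.
  - by right; exists q, (xi ++ s0); split=> //;
      apply: wb_nuC_cut; rewrite E.
case: (IH _ hP) => [h|[q [s' [E h]]]]; first by left; apply: wb_nu_fresh.
right; exists q, s'; split=> //; apply: wb_nu_fresh h.
by apply: contra cs'; rewrite E !inE => ->; rewrite !orbT.
Qed.

(** Opening turns [OutSpecFree] into [OutSpecExtr] when [c] is the transmitted continuation: c^O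
    heads the inner stack, so [xi] is empty and c^I is left on top. Any other opened name leaves the
    case unchanged. *)
Lemma out_spec_open s cs a bs c P P' : wb_typed s (nu c P) ->
  (forall r, wb_typed r P -> out_spec r cs a bs P') ->
  c \in bs -> c \notin cs -> out_spec s (c :: cs) a bs P'.
Proof.
move=> hnu IH cbs cN.
case: (wb_nu_inv hnu) => [[xi [s0 [-> hP]]]|[cs' hP]].
  have k := wb_typed_is_stack hP; have [cC _ s01 cNs] := stack_cut k.
  case: (IH _ hP) => [s' aC bsA E h|b p s' aO E bA pC pN Es h
    |b p aO E bA pC pcs s11 h|aI bsA h].
  - by rewrite (negPf (allA_notin cC bsA)) in cbs.
  - have cp : c = p.
      by apply/eqP; move: cbs; rewrite E mem_rcons inE (negPf (allA_notin cC bA)) orbF.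
    subst p; case: xi Es cNs {hP k} => [[Es] cNs|t xi /= [-> _]]; last first.
      by rewrite mem_head.
    apply: (OutSpecExtr aO E bA pC (mem_head _ _)) => //=; by rewrite Es.
  - have cp : c = p.
      by apply/eqP; move: cbs; rewrite E mem_rcons inE (negPf (allA_notin cC bA)) orbF.
    by rewrite cp pcs in cN.
  - by rewrite (negPf (allA_notin cC bsA)) in cbs.
case: (IH _ hP) => [s' aC bsA E h|b p s' aO E bA pC pN Es h
    |b p aO E bA pC pcs s11 h|aI bsA h].
- exact: OutSpecC aC bsA E h.
- apply: (OutSpecFree aO E bA pC _ Es) => //; rewrite inE negb_or pN andbT.
  by apply: contraNneq cs' => <-; rewrite Es mem_head.
- by apply: (OutSpecExtr aO E bA pC) => //; rewrite inE pcs orbT.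
- exact: OutSpecI.
Qed.

(** * Outputs and inputs of typed processes *)

Lemma in_spec_psubst s u bs cs P : map (@nsort S) cs = map (@nsort S) bs ->
  wb_typed s (PGrd (inp u bs P)) -> in_spec s u cs (psubst bs cs P).
Proof.
move=> Ecs; move ER : (PGrd _) => R h.
have szc : size cs = size bs by move/(congr1 size): Ecs; rewrite !size_map.
case: h ER => // {s R}.
- move=> q bs' p Q qC bsA U' pC pq h [-> E Ec]; rewrite E in Ecs.
  have szc' : size cs = size bs' by move/(congr1 size): Ecs; rewrite !size_map.
  apply: InSpecC; rewrite ?(all_isA_sort Ecs) ?mem_head // => s' [<-].
  rewrite (close_psubst Ec szc szc').
  by have := wb_typed_psubst Ecs h; rewrite nth_default // memNindex ?szc' // allA_notin.
- move=> x bs' p Q xO bsA U' pC h [-> E Ec]; rewrite E in Ecs.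
  have szc' : size cs = size (rcons bs' p).
    by move/(congr1 size): Ecs; rewrite !size_map.
  have [cs' [q [Ecs' E' Eq]]] := map_rconsP Ecs.
  apply: (InSpecO xO Ecs'); rewrite ?(all_isA_sort E') ?(isC_sort Eq) // => _.
  rewrite (close_psubst Ec szc szc').
  have := wb_typed_psubst Ecs h; rewrite {1}Ecs' nth_index_rcons // ?allA_notin //.
  by move/(congr1 size): E'; rewrite !size_map.
- move=> x bs' p Q xO bsA U' pC h [-> E Ec]; rewrite E in Ecs.
  have szc' : size cs = size bs' by move/(congr1 size): Ecs; rewrite !size_map.
  apply: InSpecI; rewrite ?(all_isA_sort Ecs) //.
  rewrite (close_psubst Ec szc szc').
  by have := wb_typed_psubst Ecs h; rewrite nth_default // memNindex ?szc' // allA_notin.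
Qed.

Lemma wb_rep_inv s u bs P : wb_typed s (rep u bs P) ->
  s = [::] /\ wb_typed [::] (PGrd (inp u bs P)).
Proof.
rewrite /inp; move ER : (rep u bs P) => R h; case: h ER => // {s R}.
by move=> x cs p Q xO csA U pC h [-> -> ->]; split=> //; apply: wb_inO.
Qed.

Lemma in_spec_rep s u bs cs P : map (@nsort S) cs = map (@nsort S) bs ->
  wb_typed s (rep u bs P) -> in_spec s u cs (PPar (psubst bs cs P) (rep u bs P)).
Proof.
move=> E h; have [Es hin] := wb_rep_inv h; subst s.
(* A replicated input acts as a single input in parallel with the replication, both on the empty
   stack. *)
apply: in_spec_par (in_spec_psubst E hin) _ h _; first exact: is_stack_nil.
by split; [exact: is_stack_nil|constructor].
Qed.

Lemma wb_match_inv s a b G :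
  wb_typed s (PGrd (mtch a b G)) -> wb_typed s (PGrd G).
Proof. by move ER : (PGrd _) => R h; case: h ER => // ? ? ? _ _ h [_ _ ->]. Qed.

Lemma wb_sum_inv s G G' : wb_typed s (PGrd (GSum G G')) ->
  wb_typed s (PGrd G) /\ wb_typed s (PGrd G').
Proof. by move ER : (PGrd _) => R h; case: h ER => // ? ? ? _ h h' [-> ->]. Qed.

Lemma wb_tau_inv s P : wb_typed s (PGrd (GTau P)) -> wb_typed s P.
Proof. by move ER : (PGrd _) => R h; case: h ER => // ? ? _ h [->]. Qed.

Lemma Fr_inj : injective (@Fr S).
Proof. by move=> a b []. Qed.

Lemma out_inj a bs b cs : out a bs = out b cs -> a = b /\ bs = cs.
Proof. by case=> -> /(inj_map Fr_inj). Qed.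

Lemma out_spec_out s a bs : wb_typed s (out a bs) ->
  out_spec s [::] a bs (PGrd GNil).
Proof.
move ER : (out _ _) => R h; case: h ER => // {s R}.
- move=> p cs pC csA /out_inj [-> ->].
  by apply: (OutSpecC pC csA erefl); apply: wb_nil.
- move=> x cs p xO csA pC /out_inj [-> ->].
  by apply: (OutSpecFree xO erefl csA pC _ erefl) => //; apply: wb_nil.
- by move=> u cs uI csA /out_inj [-> ->]; apply: OutSpecI => //; apply: wb_nil.
Qed.

Lemma out_step_typed s P cs a bs P' :
  step P (LOut cs a bs) P' -> wb_typed s P -> out_spec s cs a bs P'.
Proof.
move Em : (LOut cs a bs) => m st; elim: st cs a bs Em s => {P m P'} //.
- by move=> a bs _ _ _ [-> -> ->] s; apply: out_spec_out.
- by move=> a G m P' _ IH cs b bs /IH{}IH s /wb_match_inv /IH.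
- by move=> G G' m P' _ IH cs b bs /IH{}IH s /wb_sum_inv [/IH].
- by move=> G G' m P' _ IH cs b bs /IH{}IH s /wb_sum_inv [_ /IH].
- move=> P Q m P' _ IH dj cs a bs Em s /wb_par_inv [s1 [s2 [h1 h2 i]]].
  move: dj; rewrite -Em; apply: out_spec_par h2 i; last exact: wb_typed_is_stack h1.
  exact: IH.
- move=> P Q m Q' _ IH dj cs a bs Em s /wb_par_inv [s1 [s2 [h1 h2 i]]].
  apply: (out_spec_mono (fun r => @wb_parC r _ _)); move: dj; rewrite -Em.
  apply: out_spec_par h1 (interleavingC i); last exact: wb_typed_is_stack h2.
  exact: IH.
- move=> c P m P' _ IH cN cs a bs Em s h; rewrite -Em in cN.
  by apply: out_spec_nu h _ cN => r; apply: IH.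
- move=> c P cs a bs P' _ IH cb cN _ _ _ _ [-> -> ->] s h.
  by apply: out_spec_open h _ cb cN => r; apply: IH.
Qed.

Lemma in_step_typed s P a bs P' :
  step P (LIn a bs) P' -> wb_typed s P -> in_spec s a bs P'.
Proof.
move Em : (LIn a bs) => m st; elim: st a bs Em s => {P m P'} //.
- by move=> a bs cs P U E _ _ [-> ->] s; apply: in_spec_psubst.
- by move=> a bs cs P U E _ _ [-> ->] s; apply: in_spec_rep.
- by move=> a G m P' _ IH b bs /IH{}IH s /wb_match_inv /IH.
- by move=> G G' m P' _ IH b bs /IH{}IH s /wb_sum_inv [/IH].
- by move=> G G' m P' _ IH b bs /IH{}IH s /wb_sum_inv [_ /IH].
- move=> P Q m P' _ IH dj a bs Em s /wb_par_inv [s1 [s2 [h1 h2 i]]].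
  apply: in_spec_par h2 i; last exact: wb_typed_is_stack h1.
  exact: IH.
- move=> P Q m Q' _ IH dj a bs Em s /wb_par_inv [s1 [s2 [h1 h2 i]]].
  apply: (in_spec_mono (fun r => @wb_parC r _ _)).
  apply: in_spec_par h1 (interleavingC i); last exact: wb_typed_is_stack h2.
  exact: IH.
- move=> c P m P' _ IH cN a bs Em s h; rewrite -Em in cN.
  by apply: in_spec_nu h _ cN => r; apply: IH.
Qed.

(** * Communication and internal steps *)

Lemma extruded_sub P cs a bs P' : step P (LOut cs a bs) P' -> {subset cs <= bs}.
Proof.
move Em : (LOut cs a bs) => m st; elim: st cs a bs Em => {P m P'} //; try by eauto.
- by move=> a bs _ _ _ [-> _ ->].
- move=> c P cs a bs P' _ IH cb _ _ _ _ _ [-> _ ->] b; rewrite inE.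
  by case/orP => [/eqP -> //|]; apply: IH.
Qed.

Lemma wb_nus s cs P : all (@isA S) cs -> wb_typed s P -> wb_typed s (nus cs P).
Proof. by move=> + h; elim: cs => //= c cs IH /andP [cA /IH]; apply: wb_nuA. Qed.

(** [cs] may repeat [p]: the innermost restriction of [p] removes the pair, and outer ones bind an
    absent name. *)
Lemma wb_nus_extr s cs p P : (forall c, c \in cs -> isA c \/ c = p) -> p \in cs ->
  wb_typed [:: (p, TO), (p, TI) & s] P -> wb_typed s (nus cs P).
Proof.
move=> + + h; have [pC _ _ pN] := is_stack_pair (wb_typed_is_stack h).
elim: cs => //= c cs IH H; have {}IH := IH (fun b bcs => H b (@mem_behead _ (c :: cs) b bcs)).
have [pcs _|pcs] := boolP (p \in cs).
  case: (H c (mem_head _ _)) => [cA|->]; first by apply: wb_nuA => //; apply: IH.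
  by apply: wb_nuC' => //; apply: IH.
rewrite inE (negPf pcs) orbF => /eqP <-; apply: (wb_nuC_cut (xi := [::])).
apply: wb_nus h; apply/allP => b bcs.
by case: (H b); rewrite ?inE ?bcs ?orbT // => bp; rewrite -bp bcs in pcs.
Qed.

(** At a continuation both tags pop; a free continuation sent along moves p^O from sender to
    receiver; an extruded one creates a pair that [nus cs] hides at once; otherwise nothing changes.
    [R] stands for the composition in either order. *)
Lemma tau_spec_comm s s1 s2 cs a bs P Q R :
  out_spec s1 cs a bs P -> is_stack s1 -> in_spec s2 a bs Q -> is_stack s2 ->
  interleaving s s1 s2 -> {subset cs <= bs} -> (forall p, isC p -> p \in cs -> p \notin names s2) ->
  (forall r, wb_typed r (PPar P Q) -> wb_typed r R) -> tau_spec s (nus cs R).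
Proof.
move=> ho k1 hi k2 [k sh] sub fr PQR.
have csA : all (@isA S) bs -> all (@isA S) cs by move/allP => bA; apply/allP => c /sub /bA.
case: ho => [s' aC bsA E hP|b p s' aO E bA pC pN Es hP
  |b p aO E bA pC pcs s11 hP|aI bsA hP];
  case: hi => [aC' bsA' ai hQ|b' p' aO' E' bA' pC' hQ|aI' bsA' hQ];
  try by exfalso; eauto using isC_isO, isC_isI, isO_isI.
- subst s1; have [_ [s0 Es sh']] := shuffle_TO_head k k1 k2 sh; subst s.
  have [_ k0 _ _ hd] := (is_stack_TO a s0).1 k.
  (* The receiver holds a^I, which must follow a^O in [s] and therefore heads its stack. *)
  have [|r Er] := hd; first by rewrite (shuffle_mem sh') mem_cat ai orbT.
  subst s0; right; exists a, r; split=> //.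
  have [s2' E2 sh''] := shuffle_cons_memE (stack_uniq k0) (shuffleC sh') ai.
  apply: wb_nus; [exact: csA|apply: PQR]; apply: wb_par hP (hQ _ E2) _.
  by split; [apply: is_stack_behead k0|apply: shuffleC].
- left; have [_ Ep] : (b, p) = (b', p') by apply: rcons_inj; rewrite -E.
  subst p' s1; have [s20 [s0 Es sh']] := shuffle_TO_head k k1 k2 sh; subst s.
  have [_ k0 _ pN0 hd] := (is_stack_TO p s0).1 k.
  apply: wb_nus.
    apply/allP => c cc; have := sub c cc; rewrite E mem_rcons inE.
    case/orP => [/eqP cp|/(allP bA) //]; by rewrite -cp cc in pN.
  apply: PQR; apply: wb_par hP (hQ _) _; last by split=> //; apply: sh_r.
  apply/is_stack_TO; split=> //.
    by apply: contra pN0; rewrite (shuffle_mem sh') mem_cat orbC => ->.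
  move=> p2; have [|r Er] := hd; first by rewrite (shuffle_mem sh') mem_cat p2 orbT.
  subst s0.
  by have [s2' E2 _] := shuffle_cons_memE (stack_uniq k0) (shuffleC sh') p2; exists s2'.
- left; have [_ Ep] : (b, p) = (b', p') by apply: rcons_inj; rewrite -E.
  subst p'.
  (* The sender already has the single excess output, so p^O can be pushed on the receiver's
     stack. *)
  have s20 : seq_of s2 = 0 /\ seq_of s = 1.
    have := shuffle_seq_of k k1 k2 sh; rewrite s11.
    by have := seq_of_le1 s; case: (seq_of s) => [|[|?]] //; case: (seq_of s2).
  have p2 := fr p pC pcs.
  have pI t : (p, t) \in s2 -> False by move/(map_f fst); rewrite (negPf p2).
  have /is_stack_TI [_ _ _ p1] := wb_typed_is_stack hP.
  have ps : p \notin names s.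
    by rewrite /names (eq_mem_map _ (shuffle_mem sh)) map_cat mem_cat negb_or p1.
  apply: (@wb_nus_extr _ _ p) => //.
    move=> c /sub; rewrite E mem_rcons inE => /orP [/eqP ->|/(allP bA)]; by [right|left].
  apply: PQR; apply: wb_par hP (hQ _) _.
    apply/is_stack_TO; split=> //; first by case: s20.
      by apply/negP => /pI.
    by move/pI.
  (* On top of [s], p^O is taken from the receiver and p^I from the sender. *)
  split; last by apply: sh_r; apply: sh_l.
  apply/is_stack_TO; split=> //.
  + by apply/is_stack_TI; split=> //; case: s20.
  + by rewrite inE negb_or xpair_eqE andbF /=; apply: contra ps => /(map_f fst).
  + by exists s.
- by left; apply: wb_nus; [exact: csA|apply: PQR; apply: wb_par hP hQ _].
Qed.

Lemma tau_step_typed s P P' : step P LTau P' -> wb_typed s P -> tau_spec s P'.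
Proof.
move Em : LTau => m st; elim: st Em s => {P m P'} //.
- by move=> P _ s /wb_tau_inv h; left.
- by move=> a G m P' _ IH /IH{}IH s /wb_match_inv /IH.
- by move=> G G' m P' _ IH /IH{}IH s /wb_sum_inv [/IH].
- by move=> G G' m P' _ IH /IH{}IH s /wb_sum_inv [_ /IH].
- move=> P Q m P' _ IH dj Em s /wb_par_inv [s1 [s2 [h1 h2 i]]].
  apply: tau_spec_par h2 i; last exact: wb_typed_is_stack h1.
  exact: IH.
- move=> P Q m Q' _ IH dj Em s /wb_par_inv [s1 [s2 [h1 h2 i]]].
  apply: (tau_spec_mono (fun r => @wb_parC r _ _)).
  apply: tau_spec_par h1 (interleavingC i); last exact: wb_typed_is_stack h2.
  exact: IH.
- move=> P Q cs a bs P' Q' st1 _ st2 _ /hasPn dj _ s /wb_par_inv [s1 [s2 [h1 h2 i]]].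
  have [k1 k2] := (wb_typed_is_stack h1, wb_typed_is_stack h2).
  apply: tau_spec_comm (out_step_typed st1 h1) k1 (in_step_typed st2 h2) k2 i
    (extruded_sub st1) _ _ => //.
  by move=> p pC /dj /=; apply: contra => /(names_sub_fn h2).
- move=> P Q cs a bs P' Q' st1 _ st2 _ /hasPn dj _ s /wb_par_inv [s1 [s2 [h1 h2 i]]].
  have [k1 k2] := (wb_typed_is_stack h1, wb_typed_is_stack h2).
  apply: tau_spec_comm (out_step_typed st2 h2) k2 (in_step_typed st1 h1) k1
    (interleavingC i) (extruded_sub st2) _ (fun r => @wb_parC r _ _).
  by move=> p pC /dj /=; apply: contra => /(names_sub_fn h1).
- move=> c P m P' _ IH _ Em s h; apply: tau_spec_nu h _ => r; exact: IH.
Qed.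

End Typing.

(** * Preservation of typing by typed transitions *)

Theorem mainTheorem9 (S : sorting) (s s' : seq (tname S)) (P P' : proc S)
    (m : label S) (hP : well_sorted P) (hs : wb_typed s P)
    (hstep : conf_step s P m s' P') : wb_typed s' P'.
Proof.
have k := wb_typed_is_stack hs.
case: hstep => -[_ [_ st al] fr] cOC cIC cEx cOA cIA cTp cT cO.
case: m st al fr cOC cIC cEx cOA cIA cTp cT cO
  => [|a bs|cs a bs] st al fr cOC cIC cEx cOA cIA cTp cT cO.
- case: (tau_step_typed st hs) => [h|[q [r [Es h]]]].
    (* If [P'] is typed by [s] itself, a name on top of [s] is still free in [P'], so the popping
       clause cannot apply. *)
    rewrite cT // => -[p [r [Es pN]]]; move: pN.
    have [pC _ _ _] := is_stack_pair (eq_ind s (@is_stack S) k _ Es).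
    by rewrite (wb_typed_mem_fn h pC) Es mem_head.
  have [qC _ _ qN] := is_stack_pair (eq_ind s (@is_stack S) k _ Es).
  by rewrite (cTp q r erefl Es) // (wb_typed_mem_fn h qC).
- case: (in_step_typed st hs) => [aC bsA ai h|b p aO E bA pC h|aI bsA h].
  + exact: h (cIC _ _ aC erefl).
  + subst bs; rewrite (cIA _ _ _ (isO_isA aO) pC erefl); apply: h.
    (* Here the side conditions are used: sequentiality excludes this input when [s] starts with an
       output, and a received [p] already in [s] must head it, hence as p^I. So p^O can be
       pushed. *)
    have s0 : seq_of s = 0 by case: al => // -[_ /= /(isO_isI aO)].
    have pI : p \in names s -> exists r, s = (p, TI) :: r.
      move=> ps; have [|t [r [Es _]]] := fr p pC _ ps.
        by rewrite mem_filter inE mem_rcons mem_head orbT.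
      by exists r; move: s0; rewrite Es; case: t {Es}.
    apply/is_stack_TO; split=> //; last by move/(map_f fst); exact: pI.
    apply/negP => pO; have [r Es] := pI (map_f fst pO).
    move: k pO; rewrite Es => /is_stack_TI [_ _ _ pN].
    by rewrite inE xpair_eqE andbF /= => /(map_f fst); rewrite (negPf pN).
  + by rewrite cO //= bsA isI_isA.
- have sub := extruded_sub st.
  case: (out_step_typed st hs) => [r aC bsA Es h|b p r aO E bA pC pN Es h
    |b p aO E bA pC pcs s1 h|aI bsA h].
  + by have := cOC _ _ _ aC erefl; rewrite Es => -[<-].
  + subst bs; have := cOA _ _ _ _ (isO_isA aO) pC erefl pN.
    by rewrite Es => -[<-].
  + by subst bs; rewrite (cEx _ _ _ _ (isO_isA aO) pC erefl pcs).
  + rewrite cO //= all_cat /= bsA (isI_isA aI) !andbT.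
    by apply/allP => c /sub /(allP bsA).
Qed.
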